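(* Let $p$ be a prime, $G$ a finite group, $E$ a normal subgroup of $G$ and $P$ a Sylow $p$-subgroup of $E$, where $(|E|,p-1)=1$. If either every maximal subgroup of $P$ satisfies partial $\Pi$-property in $G$, or every cyclic subgroup of $P$ of prime order or of order $4$ (the latter only when $P$ is not quaternion-free) satisfies partial $\Pi$-property in $G$, then $E$ is $p$-nilpotent.
   Context: All groups are finite. For a positive integer $n$ and a set of primes $\pi$, $n$ is a $\pi$-number if all its prime divisors lie in $\pi$ (so $1$ is a $\pi$-number for every $\pi$, including $\pi=\emptyset$); $\pi(H)$ is the set of prime divisors of $|H|$. Partial $\Pi$-property: a subgroup $H$ of $G$ satisfies partial $\Pi$-property in $G$ if there exists a chief series $1=G_0<G_1<\cdots<G_n=G$ of $G$ such that for every $1\leq i\leq n$, the index $|G/G_{i-1}:N_{G/G_{i-1}}(HG_{i-1}/G_{i-1}\cap G_i/G_{i-1})|$ is a $\pi(HG_{i-1}/G_{i-1}\cap G_i/G_{i-1})$-number. A group is quaternion-free if it has no section isomorphic to the quaternion group of order $8$; thus the condition on cyclic subgroups of order $4$ is imposed only when $p=2$ and $P$ is not quaternion-free. *)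

(* Defs.v *)
From mathcomp Require Import all_boot all_fingroup all_solvable.

Set Implicit Arguments.
Unset Strict Implicit.
Unset Printing Implicit Defensive.

Local Open Scope group_scope.
Import GroupScope.

(* The tail s = [:: G_1; ...; G_n] encodes 1 = G_0 < G_1 < ... < G_n = G. *)
Definition chief_series (gT : finGroupType) (G : {group gT})
    (s : seq {group gT}) : Prop :=
  (G.-chief).-series 1%G s /\ last 1%G s = G.

(* V is normal in G below, so the library's H / V is the textbook HV / V. *)
Definition partial_Pi_property (gT : finGroupType) (G H : {group gT}) : Prop :=
  exists s : seq {group gT},
    chief_series G s /\
    forall i : nat, i < size s ->
      let V := nth 1%G (1%G :: s) i in
      let U := nth 1%G (1%G :: s) i.+1 in
      let K := (H / V) :&: (U / V) in
      \pi(K).-nat #|G / V : 'N_(G / V)(K)|.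

Definition quaternion_free (gT : finGroupType) (G : {group gT}) : Prop :=
  forall K L : {group gT}, K \subset G -> L <| K -> ~ (K / L \isog 'Q_8).

(* Existence of a normal p-complement. *)
Definition p_nilpotent (p : nat) (gT : finGroupType) (G : {group gT}) : Prop :=
  exists N : {group gT}, N <| G /\ p^'.-Hall(G) N.

(* Main.v *)
(* A p-group H with the partial Pi-property meets a chief factor U / V of G
   nontrivially only if U / V is a p-group, and then N_G((H :&: U) V) has p-power
   index in G; if a Sylow p-subgroup of G also normalises (H :&: U) V, this
   subgroup is normal in G.  Choosing H such that this happens forces chief
   factors of order p, which E centralises because #|E| is coprime to p - 1.

   Cyclic subgroups.  In a minimal counterexample O_p'(E) = 1, and every element
   of order p (or 4) lies in a normal p-subgroup of G properly contained in E.
   Such a subgroup B0 is centralised by E: a minimal noncentral G-invariant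
   B <= B0 has class at most 2 and exponent p or 4, so that all its elements are
   subject to the hypothesis (if p = 2 and B is not abelian, B has a section
   Q_8).  Hence the elements of order p (or 4) of E are central and E is
   p-nilpotent by Ito's theorem, obtained from Frobenius' criterion and transfer.

   Maximal subgroups.  In a minimal counterexample with #|P| > p, G has a unique
   minimal normal subgroup N inside E; it is a p-group with E / N p-nilpotent,
   and it has a complement N_G(Q) in G by Schur-Zassenhaus.  If N1 has index p in
   N and is normal in a Sylow p-subgroup of G, the maximal subgroup
   N1 (P :&: N_G(Q)) of P shows that N1 is normal in G, hence N1 = 1, #|N| = p and
   E centralises N, a contradiction. *)
Require Import Defs.
From mathcomp Require Import all_boot all_fingroup ssralg finalg all_solvable.

Set Implicit Arguments.
Unset Strict Implicit.
Unset Printing Implicit Defensive.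

Local Open Scope group_scope.
Import GroupScope.

(** * Transfer and Frobenius' criterion *)

(* N is the kernel of the transfer G -> P / P', which maps x in P to the class of
   x ^ #|G : P| because x is conjugate in P to all its conjugates lying in P. *)
Lemma transfer_kernel (p : nat) (gT : finGroupType) (G P : {group gT}) :
  p.-Sylow(G) P ->
  (forall x g, x \in P -> g \in G -> x ^ g \in P ->
     exists2 u, u \in P & x ^ g = x ^ u) ->
  exists N : {group gT},
    [/\ N <| G, p.-group (G / N) & N :&: P = P^`(1)].
Proof.
move=> sylP fusP; have [sPG pP _] := and3P sylP.
pose f := restrm_morphism (der_norm 1 P) (coset_morphism P^`(1)).
have imf: f @* P = P / P^`(1) by rewrite morphim_restrm setIid.
have abf: abelian (f @* P) by rewrite imf der_abelian.
pose V := transfer_morphism G abf.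
have fus x g : x \in P -> g \in G -> x ^ g \in P -> f (x ^ g) = f x.
  move=> Px Gg Pxg; have [u Pu def] := fusP x g Px Gg Pxg.
  rewrite def morphJ // conjgE; have/centsP cf := abf.
  by rewrite -(cf (f u)) ?mulKg ?mem_morphim.
(* The transfer is a product over the [<[x]>]-orbits on the cosets of [P]. Each factor is a
   conjugate in [P] of [x ^+ k], with [k] the orbit length; [fus] turns it into [f x ^+ k], and the
   lengths add up to [#|G : P|]. *)
have VP x : x \in P -> V x = (FiniteModule.fmod abf (f x) *+ #|G : P|)%R.
  move=> Px; have Gx := subsetP sPG x Px.
  pose X := transversal (rcosets P G :* <[x]>) G.
  have trX: is_transversal X (rcosets P G :* <[x]>) G.
    by apply: transversalP; apply: rcosets_cycle_partition.
  rewrite /= (transfer_cycle_expansion sPG abf Gx trX).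
  rewrite -(sum_index_rcosets_cycle sPG Gx trX) -GRing.sumrMnr.
  apply: eq_bigr => y Xy.
  have Gy: y \in G := subsetP (transversal_sub trX) y Xy.
  have PxX: x ^+ #|<[x]> : P :* y| \in P by rewrite groupX.
  have PxJ: (x ^+ #|<[x]> : P :* y|) ^ y^-1 \in P.
    have := mulg_exp_card_rcosets P x y.
    by rewrite mem_rcoset conjgE invgK mulgA.
  by rewrite -FiniteModule.fmodX ?mem_morphim // -morphX // /restrm /= fus ?groupV // morphX ?FiniteModule.fmodX // mem_morphim.
have fP x : x \in P -> f x \in f @* P by move=> Px; rewrite mem_morphim.
exists ('ker V)%G; split; first exact: ker_normal.
  rewrite (isog_pgroup p (first_isog V)) -pnat_exponent.
  apply: (pnat_dvd (n := #|f @* P|)); last first.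
    by rewrite imf; apply: (quotient_pgroup _ pP).
  apply/exponentP=> x _; rewrite FinRing.zmodXgE -(FiniteModule.fmvalK x) -FiniteModule.fmodX ?FiniteModule.fmodP //.
  by rewrite expg_cardG ?FiniteModule.fmodP // FiniteModule.fmod1.
apply/setP=> x; rewrite inE; apply/andP/idP=> [[kx Px] | P'x].
  have := mker kx; rewrite VP // -FiniteModule.fmodX ?fP // => /(congr1 (@FiniteModule.fmval _ _ abf)).
  rewrite FiniteModule.fmodK ?groupX ?fP //= => fx1.
  (* The order of this coset divides both [#|P|] and [#|G : P|], which are coprime. *)
  have /eqP: coset P^`(1) x = 1.
    apply/eqP; rewrite -order_eq1 -dvdn1.
    have co: coprime #|P| #|G : P|.
      by case/and3P: sylP => _ pP' p'GP; apply: pnat_coprime pP' p'GP.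
    rewrite -[X in _ %| X](eqP co).
    rewrite dvdn_gcd; apply/andP; split; last by rewrite order_dvdn; apply/eqP; exact: fx1.
    have dv: #|P / P^`(1)| %| #|P| := dvdn_quotient _ _.
    by rewrite (dvdn_trans _ dv) // order_dvdG ?mem_quotient.
  by move/eqP/coset_idr; apply; apply: (subsetP (der_norm 1 P)).
have Px := subsetP (der_sub 1 P) x P'x.
split=> //; apply/kerP; first exact: (subsetP sPG).
rewrite VP // (_ : f x = 1) ?FiniteModule.fmod1 ?GRing.mul0rn //.
exact: coset_id.
Qed.

(** Any normal p-complement equals ['O_p^'(G)], so this boolean decides p-nilpotency and permits
    arguments by contradiction. *)
Definition pnil (p : nat) (gT : finGroupType) (G : {group gT}) :=
  p^'.-Hall(G) 'O_p^'(G).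

(** * Permanence of p-nilpotency, fusion, and minimal non-p-nilpotent groups *)

Section PNilpotent.

Variable p : nat.
Implicit Type gT : finGroupType.

Lemma pnilP gT (G : {group gT}) : reflect (p_nilpotent p G) (pnil p G).
Proof.
apply: (iffP idP) => [hallO | [N [nsNG hallN]]].
  by exists 'O_p^'(G)%G; split=> //; apply: pcore_normal.
by rewrite /pnil (normal_Hall_pcore hallN nsNG).
Qed.

Lemma pHall_p'E gT (G N : {group gT}) :
  N \subset G -> p^'.-Hall(G) N = (p^'.-group N) && (p.-nat #|G : N|).
Proof. by move=> sNG; rewrite /pHall sNG pnatNK. Qed.

(** ['O_p^'(N)] is characteristic in [N], hence normal in [G], and its index in [G] is still a power
    of [p]. *)
Lemma pnil_ext gT (G N : {group gT}) :
  N <| G -> p.-group (G / N) -> pnil p N -> pnil p G.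
Proof.
move=> nsNG pGN; have [sNG nNG] := andP nsNG.
rewrite /pnil pHall_p'E ?pcore_sub // => /andP[p'M pNM].
apply/pnilP; exists 'O_p^'(N)%G.
have sMN := pcore_sub p^' N.
split; first exact: gFnormal_trans.
rewrite pHall_p'E ?(subset_trans sMN) // p'M /=.
by rewrite -(Lagrange_index sNG sMN) pnatM pNM andbT -card_quotient.
Qed.

Lemma pnil_quo_p' gT (G N : {group gT}) :
  N <| G -> p^'.-group N -> pnil p (G / N) -> pnil p G.
Proof.
move=> nsNG p'N; rewrite /pnil (pquotient_pcore nsNG p'N).
have sNO: N \subset 'O_p^'(G) by apply: pcore_max.
by rewrite pquotient_pHall // (normalS sNO _ nsNG) ?pcore_sub.
Qed.

Lemma pnil_quotient gT (G N : {group gT}) :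
  N <| G -> pnil p G -> pnil p (G / N).
Proof.
move=> nsNG hallO; apply/pnilP; exists ('O_p^'(G) / N)%G.
split; first by rewrite quotient_normal ?pcore_normal.
by apply: quotient_pHall; rewrite // (subset_trans (pcore_sub _ _)) ?normal_norm.
Qed.

Lemma p'group_pnil gT (G : {group gT}) : p^'.-group G -> pnil p G.
Proof.
move=> p'G; apply/pnilP; exists G; split=> //.
by rewrite pHall_p'E // p'G indexgg.
Qed.

Lemma pgroup_pnil gT (G : {group gT}) : p.-group G -> pnil p G.
Proof.
move=> pG; apply/pnilP; exists 1%G; split; first exact: normal1.
by rewrite pHall_p'E ?sub1G // pgroup1 indexg1.
Qed.

Lemma pnil_mulG gT (G P : {group gT}) :
  pnil p G -> p.-Sylow(G) P -> 'O_p^'(G) * P = G.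
Proof.
rewrite /pnil pHall_p'E ?pcore_sub // => /andP[_ pi] /and3P[sPG _ p'i].
by apply: coprime_index_mulG => //; rewrite ?pcore_sub ?(pnat_coprime pi).
Qed.

Lemma pnil_cent gT (G D : {group gT}) :
  p.-group D -> D <| G -> 'O_p^'(G) \subset 'C(D).
Proof.
move=> pD nsDG; apply/commG1P/trivgP.
have <-: 'O_p^'(G) :&: D = 1.
  by rewrite setIC coprime_TIg ?(pnat_coprime pD) // -/(pgroup _ _) pcore_pgroup.
rewrite commg_subI // subsetI subxx.
  by rewrite (subset_trans (pcore_sub _ _)) ?normal_norm.
by rewrite (subset_trans (normal_sub nsDG)) ?gFnorm.
Qed.

(* Frobenius: descending induction on P :&: Q, working in the normaliser of the
   intersection, whose normal p-complement centralises it. *)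
Lemma Sylow_conj_cent gT (G P Q : {group gT}) :
  (forall U : {group gT}, p.-group U -> U \subset G -> U :!=: 1 ->
     pnil p 'N_G(U)) ->
  p.-Sylow(G) P -> p.-Sylow(G) Q ->
  exists2 y, y \in 'C_G(P :&: Q) & Q :=: P :^ y.
Proof.
move=> locG; have [n] := ubnP (#|P| - #|P :&: Q|).
elim: n P Q => // n IHn P Q /ltnSE-leDn sylP sylQ.
have [sPG pP _] := and3P sylP; have [sQG pQ _] := and3P sylQ.
have oPQ: #|P| = #|Q| by rewrite (card_Hall sylP) (card_Hall sylQ).
have [defD | ntD] := eqVneq (P :&: Q) 1.
  have [y Gy defQ] := Sylow_trans sylP sylQ.
  by exists y; last (by rewrite defQ); rewrite defD inE Gy; apply/centP=> _ /set1P->; apply: commute1.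
have [eqPQ | neqPQ] := eqVneq P Q.
  by exists 1; rewrite ?group1 // conjsg1 eqPQ.
pose D := (P :&: Q)%G; have pD: p.-group D := pgroupS (subsetIl P Q) pP.
have sDG: D \subset G by rewrite subIset ?sPG.
have prDP: D \proper P.
  rewrite properEneq subsetIl andbT; apply: contraNneq neqPQ => /setIidPl sPQ.
  by rewrite -val_eqE eqEcard sPQ oPQ leqnn.
have prDQ: D \proper Q.
  rewrite properEneq subsetIr andbT; apply: contraNneq neqPQ => /setIidPr sQP.
  by rewrite -val_eqE eq_sym eqEcard sQP oPQ leqnn.
have prDNP := nilpotent_proper_norm (pgroup_nil pP) prDP.
have prDNQ := nilpotent_proper_norm (pgroup_nil pQ) prDQ.
have nilN: pnil p 'N_G(D) by apply: locG.
(* [S1] and [T1] are Sylow in ['N_G(D)]; the element conjugating one to the other can be taken in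
   the normal p-complement, which centralises [D]. *)
have [S1 sylS1 sPS1] := Sylow_superset (setSI 'N(D) sPG) (pgroupS (subsetIl P _) pP).
have [T1 sylT1 sQT1] := Sylow_superset (setSI 'N(D) sQG) (pgroupS (subsetIl Q _) pQ).
have [x Nx defT1] := Sylow_trans sylS1 sylT1.
have nsDN: D <| 'N_G(D) by rewrite /normal subsetI sDG normG subsetIr.
have: x \in S1 * 'O_p^'('N_G(D)).
  by rewrite normC ?pnil_mulG // (subset_trans (pHall_sub sylS1)) ?gFnorm.
case/mulsgP=> s k Ss Kk defx.
have{x Nx defx} defT1: T1 :=: S1 :^ k by rewrite defT1 defx conjsgM conjGid.
have cDk: k \in 'C(D) := subsetP (pnil_cent pD nsDN) k Kk.
have Gk: k \in G.
  by apply: (subsetP (subset_trans (pcore_sub _ _) (subsetIl G 'N(D)))) Kk.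
have sS1G: S1 \subset G := subset_trans (pHall_sub sylS1) (subsetIl _ _).
have [S2 sylS2 sS12] := Sylow_superset sS1G (pHall_pgroup sylS1).
have sNPS2: 'N_P(D) \subset P :&: S2.
  by rewrite subsetI subsetIl (subset_trans sPS1).
have sNQS2: 'N_Q(D) \subset S2 :^ k :&: Q.
  by rewrite subsetI subsetIl andbT (subset_trans sQT1) // defT1 conjSg.
have sylS2k: p.-Sylow(G) (S2 :^ k) by rewrite pHallJ.
(* [P :&: S2] and [S2 :^ k :&: Q] contain the normalisers of [D] in [P] and [Q], which are larger
   than [D]; induction applies to both pairs. *)
have [|y1 /setIP[Gy1 cy1] defS2] := IHn P S2 _ sylP sylS2.
  apply: leq_trans leDn; apply: ltn_sub2l; last first.
    exact: proper_card (proper_sub_trans prDNP sNPS2).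
  exact: proper_card prDP.
have [|y2 /setIP[Gy2 cy2] defQ] := IHn (S2 :^ k)%G Q _ sylS2k sylQ.
  rewrite /= (card_Hall sylS2k) -(card_Hall sylP).
  apply: leq_trans leDn; apply: ltn_sub2l; last first.
    exact: proper_card (proper_sub_trans prDNQ sNQS2).
  exact: proper_card prDP.
exists (y1 * k * y2); last by rewrite defQ /= defS2 !conjsgM.
rewrite inE !groupM //=.
  by apply: (subsetP (centS _)) cy1; apply: subset_trans (proper_sub prDNP) _.
by apply: (subsetP (centS _)) cy2; apply: subset_trans (proper_sub prDNQ) _.
Qed.

(** [Sylow_conj_cent] for [P] and [P :^ g] gives [y] centralising [x ^ g] with [g * y^-1]
    normalising [P]. This element is [k * u] with [u] in [P] and [k] in the normal p-complement of
    ['N_G(P)], which centralises [P]. *)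
Lemma local_pnil_fusion gT (G P : {group gT}) x g :
  (forall U : {group gT}, p.-group U -> U \subset G -> U :!=: 1 ->
     pnil p 'N_G(U)) ->
  p.-Sylow(G) P -> x \in P -> g \in G -> x ^ g \in P ->
  exists2 u, u \in P & x ^ g = x ^ u.
Proof.
move=> locG sylP Px Gg Pxg; have [sPG pP _] := and3P sylP.
have [-> | ntx] := eqVneq x 1; first by exists 1; rewrite ?conj1g.
have ntP: P :!=: 1 by apply/trivgPn; exists x.
have sylPg: p.-Sylow(G) (P :^ g) by rewrite pHallJ.
have [y /setIP[Gy cy] defPg] := Sylow_conj_cent locG sylP sylPg.
have cxy: x ^ g \in 'C[y].
  by apply/cent1P; apply: commute_sym; apply: (centP cy); rewrite inE Pxg memJ_conjg.
have Nh: g * y^-1 \in 'N_G(P).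
  rewrite inE groupM ?groupV //=; apply/normP.
  by rewrite conjsgM defPg -conjsgM mulgV conjsg1.
have nilN: pnil p 'N_G(P) by apply: locG.
have sylPN: p.-Sylow('N_G(P)) P by rewrite (pHall_subl _ _ sylP) ?subsetIl // subsetI sPG normG.
have nsPN: P <| 'N_G(P) by rewrite /normal subsetI sPG normG subsetIr.
have: g * y^-1 \in 'O_p^'('N_G(P)) * P by rewrite pnil_mulG.
case/mulsgP=> k u Kk Pu defgy; exists u => //.
have cxk: x ^ k = x.
  by rewrite conjgE -(centP (subsetP (pnil_cent pP nsPN) k Kk) x Px) mulKg.
have ->: g = k * u * y by rewrite -defgy mulgKV.
have cxy': (x ^ u) ^ y = x ^ u.
  have: x ^ (g * y^-1) = x ^ u by rewrite defgy conjgM cxk.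
  move=> <-; rewrite -conjgM mulgKV conjgM.
  by rewrite [RHS]conjgE invgK; have /cent1P cc := cxy; rewrite mulgA -cc mulgK.
by rewrite !conjgM cxk.
Qed.

Lemma minimal_non_pnil_pcore gT (G : {group gT}) :
  (forall H : {group gT}, H \proper G -> pnil p H) -> ~~ pnil p G ->
  'O_p(G) != 1.
Proof.
move=> minG; apply: contraNneq => Op1.
have [P sylP] := Sylow_exists p G; have [sPG pP _] := and3P sylP.
have [P1 | ntP] := eqVneq P 1%G.
  apply: p'group_pnil; rewrite -partG_eq1 -(card_Hall sylP) P1 /= cards1 //.
have locG (U : {group gT}) : p.-group U -> U \subset G -> U :!=: 1 -> pnil p 'N_G(U).
  move=> pU sUG ntU; apply: minG; rewrite properEneq subsetIl andbT.
  apply: contraNneq ntU => defN; rewrite -subG1 -Op1 pcore_max //.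
  by rewrite /normal sUG -{1}defN subsetIr.
have [N [nsNG pGN defP']] :=
  transfer_kernel sylP (fun x g => local_pnil_fusion (x := x) (g := g) locG sylP).
apply: (pnil_ext nsNG pGN); apply: minG.
rewrite properEneq normal_sub // andbT; apply/eqP=> defN.
have:= sol_der1_proper (pgroup_sol pP) (subxx _) ntP.
by rewrite -defP' defN (setIidPr sPG) properxx.
Qed.
End PNilpotent.

(** * Recognition of the quaternion group *)

(** The image of [A] in [Aut C] has order dividing both [#|A|] and [#|C|.-1]. *)
Lemma cent_prime_order (gT : finGroupType) (A C : {group gT}) :
  prime #|C| -> A \subset 'N(C) -> coprime #|A| #|C|.-1 -> A \subset 'C(C).
Proof.
move=> pr nCA co; rewrite -ker_conj_aut ker_trivg_morphim nCA /= subG1 trivg_card1.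
rewrite -dvdn1 -(eqP co) dvdn_gcd dvdn_morphim /=.
have <-: #|Aut C| = #|C|.-1 by rewrite card_Aut_cyclic ?prime_cyclic ?totient_prime.
by rewrite cardSg ?Aut_conj_aut.
Qed.

(** Fusion in [P] happens in ['N_E(P)], which centralises [P]; hence the transfer kernel meets [P]
    trivially. *)
Lemma Burnside_prime_Sylow (p : nat) (gT : finGroupType) (E P : {group gT}) :
  prime p -> p.-Sylow(E) P -> #|P| = p -> coprime #|E| p.-1 -> pnil p E.
Proof.
move=> p_pr sylP oP co; have [sPE pP _] := and3P sylP.
have prP: prime #|P| by rewrite oP.
have cN: 'N_E(P) \subset 'C(P).
  rewrite cent_prime_order ?subsetIr // oP.
  by apply: coprime_dvdl co; rewrite cardSg ?subsetIl.
have fus x g : x \in P -> g \in E -> x ^ g \in P ->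
     exists2 u, u \in P & x ^ g = x ^ u.
  move=> Px Eg Pxg; exists 1 => //; rewrite conjg1.
  have [-> | ntx] := eqVneq x 1; first by rewrite conj1g.
  have gen y : y \in P -> y != 1 -> <[y]> = P.
    by move=> Py nty; rewrite -(nt_gen_prime prP) // !inE nty.
  have Ng: g \in 'N_E(P).
    rewrite inE Eg; apply/normP; rewrite -{1}(gen x) // -cycleJ gen //.
    by rewrite -(conj1g g) (inj_eq (conjg_inj g)).
  by rewrite conjgE -(centP (subsetP cN g Ng) x Px) mulKg.
have [N [nsNE pEN defP']] := transfer_kernel sylP fus.
apply: (pnil_ext nsNE pEN); apply: p'group_pnil.
have sylNP: p.-Sylow(N) (N :&: P) by apply: Sylow_setI_normal nsNE sylP.
move: sylNP; rewrite defP' (derG1P _) ?cyclic_abelian ?prime_cyclic //.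
by rewrite /pHall sub1G indexg1 => /and3P[].
Qed.

(** The relations present the group as an image of ['Q_8]; an image of order at most 4 would be
    abelian. *)
Lemma Q8_recognition (gT : finGroupType) (a b : gT) :
  a ^+ 2 = [~ a, b] -> b ^+ 2 = [~ a, b] -> [~ a, b] ^+ 2 = 1 ->
  [~ a, b] != 1 -> <[a]> <*> <[b]> \isog 'Q_8.
Proof.
move=> a2 b2 c2 ntc; set H := (<[a]> <*> <[b]>)%G.
have homH: H \homg 'Q_8.
  rewrite (Grp_quaternion (isT : 2 < 3)) /=; apply/existsP; exists (a, b).
  rewrite /= !xpair_eqE; apply/and4P; split=> //.
    by rewrite (expgM a 2 2) a2 c2.
  - by rewrite a2 b2.
  rewrite conjg_mulR -a2; apply/eqP; rewrite -expgS; apply: (mulIg a).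
  by rewrite -expgSr mulVg (expgM a 2 2) a2 c2.
have Ha: a \in H by rewrite -cycle_subG joing_subl.
have Hb: b \in H by rewrite -cycle_subG joing_subr.
apply/(isoGrpP _ (Grp_quaternion (isT : 2 < 3))); split; last first.
  by rewrite -(Grp_quaternion (isT : 2 < 3)).
rewrite (@card_quaternion 3) //.
have: #|H| %| 2 ^ 3 by rewrite -(@card_quaternion 3) // card_homg.
case/dvdn_pfactor=> // [[|[|[|[|m]]]]] // _ oH.
1-3: case/negP: ntc; apply/commgP.
1-3: suffices abH: abelian H by apply: (centsP abH).
1-3: by apply: (@p2group_abelian _ 2); rewrite /pgroup oH ?pnatX // pfactorK.
Qed.

Lemma invg_sq1 (gT : finGroupType) (u : gT) : u ^+ 2 = 1 -> u^-1 = u.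
Proof. by move=> u2; apply: (mulgI u); rewrite mulgV -u2. Qed.

(* Otherwise all elements of square c commute.  If a is one of them, not
   central, each b outside C(a) is an involution inverting C(a), so a^-1 a^x is
   central for all x in E; hence [B, E] centralises a, contradicting B = [B, E]. *)
Lemma ex_noncommuting_order4 (gT : finGroupType) (B E : {group gT}) (c : gT) :
  c != 1 -> c ^+ 2 = 1 -> c \in 'C(B) -> c \in 'C(E) ->
  E \subset 'N(B) -> [~: B, E] = B ->
  {in B &, forall u v, [~ u, v] = 1 \/ [~ u, v] = c} ->
  {in B, forall u, u ^+ 2 = 1 \/ u ^+ 2 = c} ->
  ~~ abelian B ->
  exists a b, [/\ a \in B, b \in B & [/\ a ^+ 2 = c, b ^+ 2 = c & [~ a, b] = c]].
Proof.
move=> ntc c2 cBc cEc nBE defB commB sqB nabB.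
have [/exists_inP[a Ba /exists_inP[b Bb /and3P[/eqP a2 /eqP b2 /eqP ab]]]|] :=
  boolP [exists a in B, exists b in B, [&& a ^+ 2 == c, b ^+ 2 == c & [~ a, b] == c]].
  by exists a, b.
rewrite negb_exists_in => /forall_inP none.
have {}none a b : a \in B -> b \in B -> a ^+ 2 = c -> b ^+ 2 = c -> [~ a, b] = 1.
  move=> Ba Bb a2 b2; have:= none a Ba; rewrite negb_exists_in => /forall_inP/(_ b Bb).
  by rewrite a2 b2 eqxx /=; case: (commB a b Ba Bb) => ->; rewrite ?eqxx.
have cV := invg_sq1 c2.
have sqE (w : gT) : w ^+ 2 = w * w by [].
have [a [b [Ba Bb a2 abc]]]: exists a b, [/\ a \in B, b \in B, a ^+ 2 = c & [~ a, b] = c].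
  have [u Bu /subsetPn[v]]: exists2 u, u \in B & ~~ (B \subset 'C[u]).
    apply/exists_inP; apply: contraR nabB; rewrite negb_exists_in => /forall_inP cB.
    apply/centsP=> u Bu v Bv; have := cB u Bu; rewrite negbK => /subsetP/(_ v Bv).
    by move/cent1P.
  move=> Bv /cent1P/commgP nuv.
  have uvc: [~ u, v] = c.
    case: (commB u v Bu Bv) => // uv1; case/negP: nuv.
    by apply/commgP; apply: commute_sym; apply/commgP; rewrite uv1.
  have [u2|u2] := sqB u Bu; last by exists u, v.
  have [v2|v2] := sqB v Bv; last by exists v, u; split; rewrite // -invg_comm uvc.
  have cv: c ^ v = c by rewrite conjgE (centP cBc) // mulKg.
  (* For involutions [u] and [v], the square of [u * v] is [[~ u, v]]. *)
  exists (u * v), v; split; rewrite ?groupM //.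
    have uV := invg_sq1 u2.
    have vV := invg_sq1 v2.
    by rewrite -uvc sqE commgEl conjgE -{1}uV -{1}vV !mulgA uV.
  by rewrite commMgJ uvc commgg mulg1.
have sq1 d : d \in B -> [~ a, d] = c -> d ^+ 2 = 1.
  by move=> Bd ad; case: (sqB d Bd) => // d2; case/eqP: ntc; rewrite -ad none.
(* Both [d] and [d * t] are involutions. *)
have inv d t : d \in B -> t \in B -> [~ a, d] = c -> [~ a, t] = 1 -> t ^ d = t^-1.
  move=> Bd Bt ad at1.
  have adt: [~ a, d * t] = c.
    by rewrite commgMJ at1 ad mul1g conjgE (centP cBc) // mulKg.
  have d2 := sq1 d Bd ad; have := sq1 _ (groupM Bd Bt) adt.
  have dV := invg_sq1 d2.
  rewrite sqE => dt2; apply: (mulIg t); rewrite mulVg conjgE dV.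
  by rewrite -dt2 !mulgA.
have fixA x : x \in E -> a^-1 * a ^ x \in 'C(B).
  move=> Ex; set u := _ * _.
  have Bax: a ^ x \in B by rewrite memJ_norm // (subsetP nBE).
  have ax2: (a ^ x) ^+ 2 = c by rewrite -conjXg a2 conjgE (centP cEc) // mulKg.
  have aax: [~ a, a ^ x] = 1 by rewrite none.
  (* [d] inverts both [a] and [a ^ x], and these have the same square [c]. *)
  have fixu d : d \in B -> [~ a, d] = c -> u ^ d = u.
    move=> Bd ad; rewrite conjMg conjVg (inv d a) ?commgg // (inv d (a ^ x)) //.
    rewrite invgK; apply: (mulgI a); apply: (mulIg (a ^ x)).
    by rewrite /u; move: (a ^ x) ax2 => y y2; rewrite -!mulgA mulVg mulg1 mulKVg -!sqE a2 y2.
  have ub := fixu b Bb abc.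
  apply/centP=> t Bt.
  apply/commgP/conjg_fixP.
  (* If [t] commutes with [a], then neither [b] nor [b * t] does, so both fix [u], and so does
     [t]. *)
  have [at1|] := commB a t Ba Bt; last exact: fixu.
  rewrite -{1}ub -conjgM; apply: fixu; first exact: groupM.
  by rewrite commgMJ at1 abc mul1g conjgE (centP cBc) // mulKg.
(* [[~ a, d]] is fixed by [x], and [a ^ x] differs from [a] by a factor centralising [B]. *)
have fixD x d : x \in E -> d \in B -> [~ a, d ^ x] = [~ a, d].
  move=> Ex Bd.
  have Bdx: d ^ x \in B by rewrite memJ_norm // (subsetP nBE).
  have ->: [~ a, d] = [~ a, d] ^ x.
    case: (commB a d Ba Bd) => ->; first by rewrite conj1g.
    by rewrite conjgE (centP cEc) // mulKg.
  have cu := fixA x Ex.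
  rewrite conjRg -[a ^ x](mulKVg a) commMgJ.
  have ->: [~ a^-1 * a ^ x, d ^ x] = 1 by apply/eqP/commgP; apply: (centP cu).
  rewrite mulg1; apply/esym/conjg_fixP/commgP/commute_sym/(centP cu).
  by rewrite groupR.
have: B \subset 'C[a].
  rewrite -{1}defB gen_subG; apply/subsetP=> _ /imset2P[d x Bd Ex ->].
  have := fixD x d^-1 Ex (groupVr Bd); rewrite !commgEl => /mulgI; rewrite conjVg => ad.
  apply/cent1P/commute_sym/commgP/conjg_fixP; rewrite conjgM -ad -conjgM.
  by rewrite mulVg conjg1.
move=> sBc; have /cent1P cab := subsetP sBc b Bb; case/eqP: ntc.
by rewrite -abc; apply/eqP/commgP; apply: commute_sym.
Qed.

(** * Minimal noncentral normal p-subgroups *)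

(** Only [G]-invariant [N] are considered, since the induction for a fixed [G] reaches only
    those. *)
Definition no_p_quotient (p : nat) (gT : finGroupType) (G E : {group gT}) :=
  forall N : {group gT}, N <| G -> N \subset E -> p.-group (E / N) -> N :=: E.

Lemma normal_subcent (gT : finGroupType) (G E B : {group gT}) :
  E <| G -> B <| G -> 'C_E(B) <| G.
Proof.
case/andP=> sEG nEG /andP[_ nBG].
by rewrite /normal subIset ?sEG // normsI ?norms_cent.
Qed.

(** For a p'-element [x] of [E], the p-element [y = [~ b, x]] is fixed by [x], so
    [b ^ (x ^+ k) = b * y ^+ k] and the order of [y] divides that of [x]; thus [y = 1]. Hence
    ['C_E(B)] contains all p'-elements of [E], and [E / 'C_E(B)] is a p-group. *)
Lemma cent_of_stable (p : nat) (gT : finGroupType) (G E B Y : {group gT}) :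
  no_p_quotient p G E -> E <| G -> B <| G -> p.-group B ->
  [~: B, E] \subset Y -> E \subset 'C(Y) -> E \subset 'C(B).
Proof.
move=> perfE nsEG nsBG pB sBEY cEY.
have nBE: E \subset 'N(B) := subset_trans (normal_sub nsEG) (normal_norm nsBG).
have cp' x : x \in E -> p^'.-elt x -> x \in 'C(B).
  move=> Ex p'x; apply/centP=> b Bb; apply/commute_sym/commgP; set y := [~ b, x].
  have Yy: y \in Y by rewrite (subsetP sBEY) ?mem_commg.
  have yx: y ^ x = y.
    by apply/conjg_fixP/commgP; apply: commute_sym; apply: (centP (subsetP cEY x Ex)).
  have bxk k : b ^ (x ^+ k) = b * y ^+ k.
    elim: k => [|k IHk]; first by rewrite conjg1 mulg1.
    by rewrite expgSr conjgM IHk conjMg conjXg yx conjg_mulR -/y -mulgA -expgS.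
  have: y ^+ #[x] = 1 by apply: (mulgI b); rewrite -bxk expg_order conjg1 mulg1.
  move/eqP; rewrite -order_dvdn => dvd_yx; rewrite -order_eq1.
  have py: p.-elt y.
    by apply: mem_p_elt pB _; rewrite groupMl ?groupV // memJ_norm ?(subsetP nBE).
  by rewrite -(part_pnat_id py) part_p'nat // (pnat_dvd dvd_yx).
suffices <-: 'C_E(B) = E by apply: subsetIr.
have nsC := normal_subcent nsEG nsBG.
apply: (perfE 'C_E(B)%G); rewrite ?subsetIl //=.
have nCE: E \subset 'N('C_E(B)).
  exact: subset_trans (normal_sub nsEG) (normal_norm nsC).
apply/pgroupP=> q q_pr /Cauchy[] // _ /morphimP[x Nx Ex ->] /= ox.
rewrite -(pnatE _ q_pr) -ox -(consttC p x) morphM ?groupX //=.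
rewrite [X in _ * X]coset_id ?mulg1; last by rewrite inE groupX //= cp' ?groupX ?p_elt_constt.
by rewrite -/(p_elt _ _) morph_p_elt ?groupX ?p_elt_constt.
Qed.

Section MinimalNoncentral.

Variables (p : nat) (gT : finGroupType) (G E B : {group gT}).
Hypotheses (p_pr : prime p) (nsEG : E <| G) (perfE : no_p_quotient p G E).
Hypotheses (nsBG : B <| G) (pB : p.-group B) (ncBE : ~~ (E \subset 'C(B))).
Hypothesis minB :
  forall N : {group gT}, N <| G -> N \proper B -> E \subset 'C(N).

(** By minimality this is the largest proper [G]-invariant subgroup of [B]. *)
Local Notation Y := 'C_B(E).

Lemma centBE_normal : Y <| G.
Proof. exact: normal_subcent. Qed.

Lemma centBE_proper : Y \proper B.
Proof.
by rewrite properEneq subsetIl andbT (sameP eqP setIidPl) centsC.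
Qed.

Lemma normal_sub_centBE (N : {group gT}) : N <| G -> N \proper B -> N \subset Y.
Proof.
by move=> nsNG prN; rewrite subsetI proper_sub // centsC minB.
Qed.

(** Otherwise [E] centralises [[~: B, E]] by minimality, hence [B] by [cent_of_stable]. *)
Lemma commBE : [~: B, E] = B.
Proof.
have nBE: E \subset 'N(B) := subset_trans (normal_sub nsEG) (normal_norm nsBG).
have sBEB: [~: B, E] \subset B by rewrite commg_subl.
apply/eqP; rewrite eqEproper sBEB /=; apply: contra ncBE => prBE.
apply: (cent_of_stable perfE nsEG nsBG pB (subxx _)).
apply: minB prBE.
by rewrite /normal (subset_trans sBEB) ?normsR ?normal_norm ?normal_sub.
Qed.

(** Three subgroups lemma: [[~: E, Y]] is trivial, and [[~: Y, B]] lies in [Y], which [E]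
    centralises. *)
Lemma centBE_central : B \subset 'C(Y).
Proof.
have cYE: Y \subset 'C(E) := subsetIr _ _.
suffices: [~: B, E, Y] = 1 by rewrite commBE => /commG1P.
apply: three_subgroup; first by rewrite (commG1P (_ : E \subset 'C(Y))) ?comm1G // centsC.
apply/commG1P; apply: subset_trans cYE; rewrite commg_subl.
exact: subset_trans (normal_sub nsBG) (normal_norm centBE_normal).
Qed.

Lemma expp_in_centBE b : b \in B -> b ^+ p \in Y.
Proof.
move=> Bb; have ntB: B :!=: 1 by apply: contraNneq ncBE => ->; rewrite cents1.
have sPhiY: 'Phi(B) \subset Y.
  by apply: normal_sub_centBE; rewrite ?Phi_proper ?gFnormal_trans.
apply: (subsetP sPhiY); rewrite (Phi_joing pB) mem_gen // inE.
by rewrite orbC (Mho_p_elt 1) ?(mem_p_elt pB).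
Qed.

Lemma der_sub_centBE : B^`(1) \subset Y.
Proof.
have ntB: B :!=: 1 by apply: contraNneq ncBE => ->; rewrite cents1.
apply: normal_sub_centBE; first by rewrite gFnormal_trans.
exact: sol_der1_proper (pgroup_sol pB) (subxx _) ntB.
Qed.

(** As commutators are central in [B], the elements with n-th power in [M] form a subgroup. It
    contains the generators [b^-1 * b ^ x] of [B = [~: B, E]], because [b ^+ n] lies in [Y] and is
    fixed by [x]. *)
Lemma expg_sub_of_comm (M : {group gT}) n :
  p %| n -> {in B &, forall u v, [~ u, v] ^+ 'C(n, 2) \in M} ->
  {in B, forall b, b ^+ n \in M}.
Proof.
move=> dvpn commM.
have expM u v : u \in B -> v \in B ->
    (u * v) ^+ n = u ^+ n * v ^+ n * [~ v, u] ^+ 'C(n, 2).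
  move=> Bu Bv; have cvu: B \subset 'C[[~ v, u]].
    rewrite sub_cent1 (subsetP _ _ (mem_commg Bv Bu)) //.
    by rewrite centsC (subset_trans centBE_central) ?centS ?der_sub_centBE.
  by rewrite expMg_Rmul //; apply/cent1P; apply: (subsetP cvu).
have grT: group_set [set b in B | b ^+ n \in M].
  apply/group_setP; split=> [|u v]; first by rewrite inE group1 expg1n group1.
  rewrite !inE => /andP[Bu Mu] /andP[Bv Mv]; rewrite groupM //= expM //.
  by rewrite !groupM ?commM.
have sBT: B \subset Group grT.
  rewrite -{1}commBE gen_subG; apply/subsetP=> _ /imset2P[b x Bb Ex ->].
  have Bbx: b ^ x \in B.
    by rewrite memJ_norm // (subsetP (normal_norm nsBG)) // (subsetP (normal_sub nsEG)).
  have Ybn: b ^+ n \in Y.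
    by case/dvdnP: dvpn => m ->; rewrite mulnC expgM groupX ?expp_in_centBE.
  rewrite inE commgEl groupM ?groupV //= expM ?groupV //.
  rewrite -conjXg [b ^+ n ^ x]conjgE.
  have [_ /centP cb] := setIP Ybn; rewrite (cb x) // mulKg.
  by rewrite expgVn mulVg mul1g commM ?groupV.
by move=> b /(subsetP sBT); rewrite inE => /andP[].
Qed.

Lemma commB_expp : {in B &, forall u v, [~ u, v] ^+ p = 1}.
Proof.
move=> u v Bu Bv.
have cc w : w \in B -> commute w [~ u, v].
  move=> Bw; apply: (centP (subsetP centBE_central w Bw)).
  by rewrite (subsetP der_sub_centBE) ?mem_commg.
rewrite -commXg; last exact: cc.
apply/eqP/commgP; apply: commute_sym; apply: (centP (subsetP centBE_central v Bv)).
exact: expp_in_centBE.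
Qed.

Lemma abelian_expp : abelian B -> {in B, forall b, b ^+ p = 1}.
Proof.
move=> cBB b Bb; apply/set1P; apply: (expg_sub_of_comm (M := 1%G)) Bb => // u v Bu Bv.
by rewrite (eqP (introT commgP (centsP cBB _ Bu _ Bv))) expg1n group1.
Qed.

Lemma odd_expp : odd p -> {in B, forall b, b ^+ p = 1}.
Proof.
move=> p_odd b Bb; apply/set1P; apply: (expg_sub_of_comm (M := 1%G)) Bb => // u v Bu Bv.
have p_gt2: 2 < p by apply: odd_prime_gt2.
have /dvdnP[m ->]: p %| 'C(p, 2) by apply: prime_dvd_bin.
by rewrite mulnC expgM commB_expp // expg1n group1.
Qed.

Lemma even_exp4 : p = 2 -> {in B, forall b, b ^+ 4 = 1}.
Proof.
move=> p2 b Bb; apply/set1P; apply: (expg_sub_of_comm (M := 1%G)) Bb => [|u v Bu Bv].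
  by rewrite p2.
by rewrite (_ : 'C(4, 2) = 2 * 3)%N // expgM -p2 commB_expp // expg1n group1.
Qed.

(* Modulo a hyperplane L of the central subgroup B', the commutator subgroup has
   order 2 and contains all squares. *)
Lemma nonabelian_not_quaternion_free : p = 2 -> ~~ abelian B -> ~ quaternion_free B.
Proof.
move=> p2 nabB qf; pose D := B^`(1)%G.
have pB2: 2.-group B by rewrite -p2.
have sDB: D \subset B := der_sub 1 B; have sDY: D \subset Y := der_sub_centBE.
have cDB: D \subset 'C(B) by rewrite (subset_trans sDY) // centsC centBE_central.
have cDE: D \subset 'C(E) by rewrite (subset_trans sDY) ?subsetIr.
have pD: 2.-group D := pgroupS sDB pB2.
have ntD: D :!=: 1 by apply: contra nabB => /eqP/derG1P.
have [_ _ [r oD]] := pgroup_pdiv pD ntD.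
have [L [sLD nsLD oL]] : exists L : {group gT}, [/\ L \subset D, L <| D & #|L| = 2 ^ r]%N.
  by apply: normal_pgroup; rewrite // oD pfactorK.
have nLB: B \subset 'N(L) by rewrite cents_norm // centsC (subset_trans sLD).
have nLE: E \subset 'N(L) by rewrite cents_norm // centsC (subset_trans sLD).
have oDL: #|D / L| = 2.
  by rewrite card_quotient ?normal_norm // -divgS // oD oL expnS mulnK ?expn_gt0.
have [c defc]: exists c, D / L = <[c]> by apply/cyclicP; rewrite prime_cyclic ?oDL.
have oc: #[c] = 2 by rewrite orderE -defc.
have defD: (B / L)^`(1) = [set 1; c] by rewrite -quotient_der // -cycle2g // -defc.
have DLc: c \in D / L by rewrite defc cycle_id.
(* Modulo [L] the derived subgroup of [B] is [[set 1; c]], and [E / L] takes the role of the acting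
   group. *)
have [|||||||||a [b [Ba Bb [a2 b2 ab]]]] := @ex_noncommuting_order4 _ (B / L)%G (E / L)%G c.
- by rewrite -order_gt1 oc.
- by rewrite -oc expg_order.
- exact: (subsetP (quotient_cents _ cDB)).
- exact: (subsetP (quotient_cents _ cDE)).
- by rewrite quotient_norms // (subset_trans (normal_sub nsEG)) ?normal_norm.
- by rewrite /= -quotientR // commBE.
- move=> u v Bu Bv; have: [~ u, v] \in (B / L)^`(1) by rewrite mem_commg.
  by rewrite defD => /set2P.
- move=> _ /morphimP[u Nu Bu ->]; apply/set2P; rewrite -defD -morphX // -quotient_der //.
  apply: mem_quotient; apply: (expg_sub_of_comm (M := D)) Bu => [|v w Bv Bw].
    by rewrite p2.
  by rewrite groupX ?mem_commg.
- apply/negP=> /derG1P; rewrite /= defD => /setP/(_ c).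
  by rewrite !inE eqxx orbT -order_eq1 oc.
have sKB: <[a]> <*> <[b]> \subset B / L by rewrite join_subG !cycle_subG Ba Bb.
have nsLB: L <| B by rewrite /normal nLB (subset_trans sLD).
have [K defK sLK sKB'] := inv_quotientS nsLB sKB.
apply: (qf K L sKB'); first exact: normalS sLK sKB' nsLB.
rewrite -defK; apply: Q8_recognition; rewrite ab //; first by rewrite -oc expg_order.
by rewrite -order_gt1 oc.
Qed.

End MinimalNoncentral.

(** * A weak form of the partial Pi-property *)

(* Weakening of the partial Pi-property for p-subgroups, in which repeated terms
   are allowed, so that the image of a series in a quotient group is again one;
   (H V / V) :&: (U / V) is encoded by its preimage (H :&: U) V in G. *)
Definition Pi_step (p : nat) (gT : finGroupType) (G H : {group gT}) :=
  [rel V U : {group gT} | ((V == U) || chief_factor G V U) &&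
     p.-nat #|G : 'N_G((H :&: U) <*> V)|].

Definition weak_Pi (p : nat) (gT : finGroupType) (G H : {group gT}) :=
  exists2 s : seq {group gT}, path (Pi_step p G H) 1%G s & last 1%G s = G.

Lemma chief_factor_normal (gT : finGroupType) (G V U : {group gT}) :
  chief_factor G V U -> [/\ V <| G, U <| G & V \proper U].
Proof.
case/andP=> /maxgroupp/andP[prVU nVG] nsUG; split=> //.
by rewrite /normal nVG (subset_trans (proper_sub prVU)) ?normal_sub.
Qed.

Lemma chief_factor_max (gT : finGroupType) (G V U N : {group gT}) :
  chief_factor G V U -> N <| G -> V \subset N -> N \subset U ->
  ~~ (U \subset N) -> N :=: V.
Proof.
case/andP=> /maxgroupP[_ maxV] _ nsNG sVN sNU nUN.
by apply: maxV => //; rewrite properE sNU nUN normal_norm.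
Qed.

(** The intersection in the quotient is a p-group, so the index is a p-number; the index of the
    normaliser is unchanged on passing to preimages. *)
Lemma partial_Pi_weak (p : nat) (gT : finGroupType) (G H : {group gT}) :
  p.-group H -> H \subset G -> partial_Pi_property G H -> weak_Pi p G H.
Proof.
move=> pH sHG [s [[chs lasts] Hs]]; exists s => //; apply/(pathP 1%G) => i lti.
pose V := nth 1%G (1%G :: s) i; pose U := nth 1%G s i.
have chVU: chief_factor G V U := pathP 1%G chs i lti.
have idx: \pi((H / V) :&: (U / V)).-nat #|G / V : 'N_(G / V)((H / V) :&: (U / V))| := Hs i lti.
have [nsVG nsUG prVU] := chief_factor_normal chVU; have nVG := normal_norm nsVG.
have sVU := proper_sub prVU.
rewrite -/V -/U /= chVU orbT /=; rewrite -quotientIG // in idx.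
set X := (H :&: U) <*> V.
have defX: (H :&: U) / V = X / V by rewrite quotientYidr // subIset // (subset_trans sHG).
have nsVX: V <| X by rewrite /normal joing_subr join_subG normG subIset // (subset_trans sHG).
have sXG: X \subset G by rewrite join_subG subIset ?sHG ?normal_sub.
have: p.-nat #|G / V : 'N_(G / V)(X / V)|.
  rewrite -defX; apply: (sub_in_pnat _ idx) => q _.
  exact: (pnatPpi (quotient_pgroup V (pgroupS (subsetIl H U) pH))).
rewrite -quotient_subnormG // index_quotient_eq ?subsetIl //.
apply: subset_trans (subsetIr _ _) _; rewrite subsetI normal_sub //=.
exact: subset_trans (normal_sub nsVX) (normG _).
Qed.

(** The first step at which [Q] becomes true cannot be a repetition, so it is a chief factor. *)
Lemma weak_Pi_jump (p : nat) (gT : finGroupType) (G H : {group gT})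
    (Q : pred {group gT}) :
  weak_Pi p G H -> ~~ Q 1%G -> Q G ->
  exists V U : {group gT}, [/\ chief_factor G V U, p.-nat #|G : 'N_G((H :&: U) <*> V)|, ~~ Q V & Q U].
Proof.
case=> s; elim: s (1%G : {group gT}) => [|U s IHs] V /=; first by move=> _ -> /negPf->.
case/andP=> /andP[stepVU idx] pUs lastG QV QG.
have [QU | QU] := boolP (Q U); last exact: IHs pUs lastG QU QG.
exists V, U; split=> //; case/predU1P: stepVU => // eVU.
by rewrite eVU QU in QV.
Qed.

Lemma weak_Pi_conj (p : nat) (gT : finGroupType) (G H : {group gT}) g :
  g \in G -> weak_Pi p G H -> weak_Pi p G (H :^ g)%G.
Proof.
move=> Gg [s chs lasts]; exists s => //.
have: (1%G : {group gT}) <| G by apply: normal1.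
elim: s (1%G : {group gT}) chs {lasts} => //= U s IHs V.
case/andP=> /andP[stepVU idx] pUs nsVG.
have nsUG: U <| G by case/predU1P: stepVU => [<- // | /chief_factor_normal[]].
rewrite IHs // andbT stepVU /=.
have nJ (N : {group gT}) : N <| G -> N :^ g = N.
  by move=> /normal_norm nNG; apply/normP; apply: (subsetP nNG).
have ->: (H :^ g :&: U) <*> V = ((H :&: U) <*> V) :^ g by rewrite conjYg conjIg (nJ U) ?(nJ V).
have ->: 'N_G(((H :&: U) <*> V) :^ g) = 'N_G((H :&: U) <*> V) :^ g.
  by rewrite conjIg normJ conjGid.
by rewrite -{1}(conjGid Gg) indexJg.
Qed.

(** The compatibility condition yields [H / B :&: U / B = (H :&: U) / B]. It holds when [H] is a
    p-group and [B] a p'-group, and also when [B] lies in [H]. *)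
Lemma weak_Pi_quotient (p : nat) (gT : finGroupType) (G H B : {group gT}) :
  B <| G -> H \subset G ->
  (forall U : {group gT}, U <| G -> H :&: U * B \subset (H :&: U) * B) ->
  weak_Pi p G H -> weak_Pi p (G / B) (H / B).
Proof.
move=> nsBG sHG compat [s chs lasts].
have nBG := normal_norm nsBG.
exists [seq (U / B)%G | U : {group gT} <- s]; last first.
  have <-: (1 / B)%G = 1%G by apply/val_inj/quotient1.
  by rewrite last_map lasts.
have <-: (1 / B)%G = 1%G by apply/val_inj/quotient1.
have: (1%G : {group gT}) <| G by apply: normal1.
elim: s (1%G : {group gT}) chs {lasts} => //= U s IHs V.
case/andP=> /andP[stepVU idx] pUs nsVG.
have nsUG: U <| G by case/predU1P: stepVU => [<- // | /chief_factor_normal[]].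
rewrite IHs // andbT; apply/andP; split.
  case/predU1P: stepVU => [-> | chVU]; first by rewrite eqxx.
  have [_ _ prVU] := chief_factor_normal chVU; have sVU := proper_sub prVU.
  (* If the image of the factor is nontrivial, a proper invariant [W] above [V / B] lifts to [K]
     with [U :&: K = V] by chiefness, so [K = V * B] by the modular law. *)
  have [// | neqVU] := eqVneq (V / B)%G (U / B)%G.
  rewrite /chief_factor quotient_normal // andbT; apply/maxgroupP; split.
    by rewrite properEneq neqVU quotientS // quotient_norms ?normal_norm.
  move=> W /andP[prWU nWG] sVW.
  have nsWG: W <| G / B.
    by rewrite /normal nWG (subset_trans (proper_sub prWU)) ?quotientS ?normal_sub.
  have [K defW sBK nsKG] := inv_quotientN nsBG nsWG.
  have nVB: V \subset 'N(B) := subset_trans (normal_sub nsVG) nBG.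
  have nUB: U \subset 'N(B) := subset_trans (normal_sub nsUG) nBG.
  have nKB: K \subset 'N(B) := subset_trans (normal_sub nsKG) nBG.
  have sVK: V \subset K by move: sVW; rewrite defW /= quotientSK // mulSGid.
  have nUK: ~~ (U \subset K).
    by apply: contraL prWU => sUK; rewrite defW /= properE (quotientS _ sUK) andbF.
  have defV: U :&: K = V.
    apply: (chief_factor_max chVU (N := (U :&: K)%G)); rewrite ?subsetIl //.
    - exact: normalI.
    - by rewrite subsetI sVU.
    by rewrite subsetI subxx.
  have sKUB: K \subset U * B.
    by move: (proper_sub prWU); rewrite defW /= quotientSK // (normC nUB).
  by rewrite defW /= -(setIidPl sKUB) -group_modr // (setIC K) defV quotientMidr.
set X := (H :&: U) <*> V.
have nUB := subset_trans (normal_sub nsUG) nBG.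
have nVB := subset_trans (normal_sub nsVG) nBG.
have nHUB: H :&: U \subset 'N(B) by rewrite subIset ?nUB ?orbT.
have defHU: H / B :&: U / B = (H :&: U) / B.
  apply/eqP; rewrite eqEsubset quotientI andbT.
  rewrite -(quotientYidr nUB) -quotientIG ?joing_subr //= norm_joinEl //.
  by rewrite (subset_trans (quotientS _ (compat U nsUG))) ?quotientMidr.
have defX: (H / B :&: U / B) <*> (V / B) = X / B by rewrite defHU -quotientY.
rewrite /= defX; apply: pnat_dvd idx.
apply: dvdn_trans (index_quotient (H := B) _); last first.
  by rewrite subIset // nBG.
apply: indexgS; rewrite subsetI quotientS ?subsetIl //=.
by rewrite (subset_trans _ (quotient_norm _ _)) ?quotientS ?subsetIr.
Qed.

(* As G = S N_G(K V) for a Sylow p-subgroup S containing K, the conjugates of K V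
   all lie in S V, hence so does their closure U. *)
Lemma pchief_factor (p : nat) (gT : finGroupType) (G V U K : {group gT}) :
  chief_factor G V U -> p.-group K -> K \subset U -> ~~ (K \subset V) ->
  p.-nat #|G : 'N_G(K <*> V)| -> p.-group (U / V).
Proof.
move=> chVU pK sKU nKV idx.
have [nsVG nsUG prVU] := chief_factor_normal chVU.
have sKG := subset_trans sKU (normal_sub nsUG).
have [S sylS sKS] := Sylow_superset sKG pK; have [sSG pS p'i] := and3P sylS.
have defG: S * 'N_G(K <*> V) = G.
  apply: coprime_index_mulG; rewrite ?subsetIl //.
  by rewrite coprime_sym (pnat_coprime idx).
have nSV: S \subset 'N(V) := subset_trans sSG (normal_norm nsVG).
have sKV: K <*> V \subset gcore (S <*> V) G.
  apply/bigcapsP=> g; rewrite -defG => /mulsgP[s n Ss /setIP[_ Nn] ->].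
  rewrite -sub_conjgV invMg conjsgM (normP (groupVr Nn)).
  apply: conj_subG; first by rewrite groupV mem_gen // inE Ss.
  by rewrite genS ?setSU.
have nsC: gcore (S <*> V) G <| G.
  rewrite /normal gcore_norm andbT (subset_trans (gcore_sub _ _)) //.
  by rewrite join_subG sSG normal_sub.
have sUC: U \subset gcore (S <*> V) G.
  apply: contraR nKV => nUC.
  rewrite -(chief_factor_max chVU (N := (U :&: gcore (S <*> V) G)%G)).
  - by rewrite subsetI sKU (subset_trans (joing_subl K V)).
  - exact: normalI.
  - by rewrite subsetI proper_sub //= (subset_trans (joing_subr K V)).
  - exact: subsetIl.
  by rewrite subsetI subxx.
apply: pgroupS (quotientS V (subset_trans sUC (gcore_sub _ _))) _.
by rewrite /= quotientYidr ?quotient_pgroup.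
Qed.

(** * Cyclic subgroups *)

(* Q stands for the statement that the original P is not quaternion-free: as a
   parameter it does not change when passing to subgroups and quotients of E. *)
Definition suitable (p : nat) (Q : Prop) (gT : finGroupType) (x : gT) : Prop :=
  #[x] = p \/ [/\ p = 2, #[x] = 4 & Q].

Lemma ex_minimal_noncentral (p : nat) (gT : finGroupType) (G E B0 : {group gT}) :
  B0 <| G -> p.-group B0 -> ~~ (E \subset 'C(B0)) ->
  exists B : {group gT}, [/\ B \subset B0, B <| G, p.-group B, ~~ (E \subset 'C(B))
    & forall N : {group gT}, N <| G -> N \proper B -> E \subset 'C(N)].
Proof.
move=> nsB0G pB0 ncB0.
have [|B minB sBB0] := @mingroup_exists _ (fun B => (B <| G) && ~~ (E \subset 'C(B))) B0.
  by rewrite nsB0G.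
have [/andP[nsBG ncB] min] := mingroupP minB.
exists B; split=> //; first exact: pgroupS pB0.
move=> N nsNG prN; apply/idPn=> ncN; case/andP: prN => sNB /negP[].
by rewrite -(min N) ?nsNG //= .
Qed.

(** [B] has exponent [p] unless [p = 2] and [B] is nonabelian; then its exponent divides 4 and [B]
    is not quaternion-free, which leaves [Q]. *)
Lemma minimal_noncentral_suitable (p : nat) (Q : Prop) (gT : finGroupType)
    (G E B : {group gT}) :
  prime p -> E <| G -> no_p_quotient p G E -> B <| G -> p.-group B ->
  ~~ (E \subset 'C(B)) ->
  (forall N : {group gT}, N <| G -> N \proper B -> E \subset 'C(N)) ->
  Q \/ quaternion_free B ->
  {in B, forall b, b != 1 -> suitable p Q b}.
Proof.
move=> p_pr nsEG perfE nsBG pB ncB minB Qqf b Bb ntb.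
have [p2 | p_odd] := even_prime p_pr; last first.
  by left; apply: nt_prime_order; rewrite // (odd_expp p_pr nsEG perfE nsBG pB ncB minB p_odd).
have [cBB | nabB] := boolP (abelian B).
  by left; apply: nt_prime_order; rewrite // (abelian_expp nsEG perfE nsBG pB ncB minB cBB).
have hQ : Q.
  case: Qqf => // qf.
  by case: (nonabelian_not_quaternion_free nsEG perfE nsBG pB ncB minB p2 nabB qf).
have b4: b ^+ 4 = 1 := even_exp4 nsEG perfE nsBG pB ncB minB p2 Bb.
have: #[b] %| 2 ^ 2 by rewrite order_dvdn b4.
case/dvdn_pfactor=> // [[|[|[|m]]]] // _ ob.
- by move: ntb; rewrite -order_eq1 ob.
- by left; rewrite ob p2.
by right.
Qed.

Lemma no_p_quotient_of_minimal (p : nat) (gT : finGroupType) (G E : {group gT}) :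
  (forall N : {group gT}, N <| G -> N \proper E -> pnil p N) ->
  E <| G -> ~~ pnil p E -> no_p_quotient p G E.
Proof.
move=> minE nsEG nE N nsNG sNE pEN; apply/eqP; rewrite eqEproper sNE /=.
apply: contra nE => prN; apply: pnil_ext pEN (minE N nsNG prN).
by rewrite /normal sNE (subset_trans (normal_sub nsEG)) ?normal_norm.
Qed.

(** [K] is the preimage of ['O_p^'(E / N)]. *)
Lemma pnil_quotient_kernel (p : nat) (gT : finGroupType) (G E N : {group gT}) :
  E <| G -> N <| G -> N \subset E -> pnil p (E / N) ->
  exists K : {group gT},
    [/\ K <| G, N \subset K, K \subset E, p^'.-group (K / N) & p.-nat #|E : K|].
Proof.
move=> nsEG nsNG sNE nilEN.
have nNG := normal_norm nsNG; have sEG := normal_sub nsEG.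
have nNE := subset_trans sEG nNG.
have nsOG: 'O_p^'(E / N) <| G / N by rewrite gFnormal_trans ?quotient_normal.
have [K defK sNK nsKG] := inv_quotientN nsNG nsOG.
have nNK := subset_trans (normal_sub nsKG) nNG.
have sKE: K \subset E by rewrite -(quotientSGK nNK sNE) -defK pcore_sub.
move: nilEN; rewrite /pnil pHall_p'E ?pcore_sub // => /andP[p'O].
rewrite /= defK in p'O *; rewrite index_quotient_eq ?subIset ?sNK ?orbT // => pEK.
by exists K.
Qed.

Lemma p'group_no_p_quotient (p : nat) (gT : finGroupType) (G E D : {group gT}) :
  no_p_quotient p G E -> E <| G -> D <| G -> D \subset E -> pnil p (E / D) ->
  p^'.-group (E / D).
Proof.
move=> perfE nsEG nsDG sDE nilED.
have [K [nsKG _ sKE p'KD pEK]] := pnil_quotient_kernel nsEG nsDG sDE nilED.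
rewrite -(perfE K) // /pgroup card_quotient //.
exact: subset_trans (normal_sub nsEG) (normal_norm nsKG).
Qed.

(* Ito: in a minimal counterexample Frobenius' criterion makes the Sylow
   p-subgroup normal. *)
Lemma pnil_central_suitable (p : nat) (Q : Prop) (gT : finGroupType) (E : {group gT}) :
  prime p ->
  (forall R : {group gT}, p.-group R -> R \subset E -> Q \/ quaternion_free R) ->
  (forall x, x \in E -> suitable p Q x -> x \in 'C(E)) ->
  pnil p E.
Proof.
move=> p_pr; have [n] := ubnP #|E|; elim: n E => // n IHn E /ltnSE-leEn qfE centE.
have minE (H : {group gT}) : H \proper E -> pnil p H.
  move=> prH; have sHE := proper_sub prH.
  apply: IHn; first exact: leq_trans (proper_card prH) leEn.
    by move=> R pR sRH; apply: qfE => //; apply: subset_trans sHE.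
  move=> x Hx sx; have cx := centE x (subsetP sHE x Hx) sx.
  exact: (subsetP (centS sHE)) cx.
apply/idPn=> nE.
have perfE: no_p_quotient p E E by apply: no_p_quotient_of_minimal nE => // N _; apply: minE.
pose D := 'O_p(E)%G; have pD: p.-group D := pcore_pgroup p E.
have nsDE: D <| E := pcore_normal p E.
(* A minimal noncentral subgroup inside [D] would consist of 1 and suitable elements, which are
   central. *)
have cDE: E \subset 'C(D).
  apply/idPn=> ncD; have [B [sBD nsBE pB ncB minB]] := ex_minimal_noncentral nsDE pD ncD.
  have sBE := normal_sub nsBE.
  case/negP: (ncB); rewrite centsC; apply/subsetP=> b Bb.
  have [-> | ntb] := eqVneq b 1; first exact: group1.
  apply: centE; first exact: (subsetP sBE).
  by apply: (minimal_noncentral_suitable p_pr _ perfE _ pB ncB minB) => //; apply: qfE.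
(* [E / D] has trivial p-core and p-nilpotent proper subgroups. *)
have nilED: pnil p (E / D).
  apply/idPn=> nED; have := @minimal_non_pnil_pcore p _ (E / D)%G.
  have -> : 'O_p(E / D) = 1 by apply: trivg_pcore_quotient.
  rewrite eqxx; case/(_ _ nED)/negP => // Hb prHb.
  have [H defH sDH sHE] := inv_quotientS nsDE (proper_sub prHb).
  rewrite (_ : Hb = (H / D)%G); last exact/val_inj.
  have nsDH: D <| H := normalS sDH sHE nsDE.
  apply: pnil_quotient => //; apply: minE; rewrite properE sHE /=.
  by apply: contraL prHb => sEH; rewrite defH properE /= (quotientS _ sEH) andbF.
have p'ED: p^'.-group (E / D) by apply: p'group_no_p_quotient perfE _ _ _ nilED; rewrite ?pcore_sub.
have sylD: p.-Sylow(E) D.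
  by rewrite /pHall pcore_sub pD -card_quotient ?normal_norm.
have fus x g : x \in D -> g \in E -> x ^ g \in D ->
     exists2 u, u \in D & x ^ g = x ^ u.
  move=> Dx Eg _; exists 1; rewrite // conjg1 conjgE.
  by rewrite -(centP (subsetP cDE g Eg) x Dx) mulKg.
have [N [nsNE pEN]] := transfer_kernel sylD fus.
rewrite (perfE N) ?normal_sub // (setIidPr (pcore_sub _ _)) => defD.
have D1: D :=: 1.
  apply/eqP; apply: contraT => ntD.
  by have:= sol_der1_proper (pgroup_sol pD) (subxx _) ntD; rewrite -defD properxx.
case/negP: nE; apply: p'group_pnil.
by rewrite /pgroup -(Lagrange (normal_sub nsDE)) D1 cards1 mul1n -D1 -card_quotient ?normal_norm.
Qed.

(* In a minimal noncentral B with largest proper G-invariant subgroup Y, choose z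
   in B \ Y with zY central in a Sylow subgroup of G / Y: then <z>Y is normal in
   G, so that #|B / Y| = p and E centralises B / Y. *)
Lemma cent_pgroup_weak_Pi (p : nat) (Q : Prop) (gT : finGroupType) (G E B0 : {group gT}) :
  prime p -> E <| G -> coprime #|E| p.-1 -> no_p_quotient p G E ->
  B0 <| G -> p.-group B0 ->
  {in B0, forall z, suitable p Q z -> weak_Pi p G <[z]>%G} ->
  (forall B : {group gT}, B \subset B0 -> Q \/ quaternion_free B) ->
  E \subset 'C(B0).
Proof.
move=> p_pr nsEG coE perfE nsB0G pB0 wB0 qfB0; apply/idPn=> ncB0.
have [B [sBB0 nsBG pB ncB minB]] := ex_minimal_noncentral nsB0G pB0 ncB0.
have suitB := minimal_noncentral_suitable p_pr nsEG perfE nsBG pB ncB minB (qfB0 B sBB0).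
have nsYG := centBE_normal nsEG nsBG.
have prYB := centBE_proper ncB.
have maxY := normal_sub_centBE minB.
set Y := 'C_B(E)%G in nsYG prYB maxY.
have [sYB nYB] := properP prYB.
have [sBG nBG] := andP nsBG; have nYG := normal_norm nsYG.
have [S sylS sBS] := Sylow_superset sBG pB; have [sSG pS p'iS] := and3P sylS.
have nYS := subset_trans sSG nYG.
have ntBY: B / Y != 1.
  rewrite -subG1 quotient_sub1; last exact: subset_trans sBG nYG.
  by rewrite proper_subn.
have nsBYS: B / Y <| S / Y.
  by rewrite quotient_normal // /normal sBS (subset_trans sSG).
have := meet_center_nil (quotient_nil _ (pgroup_nil pS)) nsBYS ntBY.
case/trivgPn=> zb /setIP[/morphimP[z Nz Bz ->{zb}] /setIP[_ cz]] ntz.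
have nYz: z \notin Y by apply: contra ntz => Yz; rewrite /= coset_id.
have ntz1: z != 1 by apply: contraNneq nYz => ->; apply: group1.
have wz := wB0 z (subsetP sBB0 z Bz) (suitB z Bz ntz1).
have [||V [U [chVU idx nVz Uz]]] := weak_Pi_jump (Q := fun U => z \in U) wz.
- by rewrite inE.
- exact: (subsetP sBG).
have [nsVG nsUG prVU] := chief_factor_normal chVU.
have sBU: B \subset U.
  apply: contraR nYz => nsBU; apply: (subsetP (maxY (B :&: U)%G _ _)).
  - exact: normalI.
  - by rewrite properE subsetIl subsetI subxx.
  by rewrite inE Bz.
(* [Y <*> V] does not contain [z], by the modular law; hence it equals [V], since [U / V] is
   chief. *)
have defY: Y :=: B :&: V.
  apply/eqP; rewrite eqEsubset subsetI sYB maxY ?normalI //=; last first.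
    rewrite properE subsetIl subsetI subxx /=.
    by apply: contra nVz => sBV; apply: (subsetP sBV).
  rewrite andbT; apply/negPn/negP=> nsYV.
  have nYVU: ~~ (U \subset Y <*> V) .
    apply: contra nYz => sUYV.
    have: z \in (Y <*> V) :&: B by rewrite inE (subsetP sUYV) ?Bz.
    rewrite /= norm_joinEl ?(subset_trans (normal_sub nsYG) (normal_norm nsVG)) //.
    rewrite -group_modl // mulGSid //= (setIC V) maxY ?normalI //.
    rewrite properE subsetIl subsetI subxx /=.
    by apply: contra nVz => sBV; apply: (subsetP sBV).
  case/negP: nsYV; rewrite -(chief_factor_max chVU (N := (Y <*> V)%G)) ?joing_subl ?joing_subr //.
  - by rewrite normalY.
  by rewrite join_subG (subset_trans sYB) //= proper_sub.
have defZY: (<[z]> <*> V) :&: B = <[z]> <*> Y.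
  have nVz': <[z]> \subset 'N(V) by rewrite cycle_subG (subsetP (normal_norm nsVG)) ?(subsetP sBG).
  rewrite norm_joinEl // norm_joinEl ?cycle_subG //.
  by rewrite -group_modl ?cycle_subG // (setIC V) -defY.
pose ZY := (<[z]> <*> Y)%G.
(* The normaliser of [ZY] has p'-index, as it contains [S], and p-power index, as [ZY = (<[z]> <*>
   V) :&: B]. *)
have nsZYG: ZY <| G.
  have sZYB: ZY \subset B by rewrite join_subG cycle_subG Bz.
  rewrite /normal (subset_trans sZYB) //=.
  have sSN: S \subset 'N_G(ZY).
    rewrite subsetI sSG; apply/subsetP=> x Sx; have Nx := subsetP nYS x Sx.
    rewrite inE conjYg (normP Nx) join_subG joing_subr andbT -cycleJ cycle_subG.
    rewrite conjg_mulR groupM //; first by rewrite -cycle_subG joing_subl.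
    apply: (subsetP (joing_subr <[z]> Y)); apply: coset_idr; first exact: groupR.
    rewrite morphR //; apply/eqP/commgP; apply: (centP cz).
    exact: mem_quotient.
  have sNN: 'N_G(<[z]> <*> V) \subset 'N_G(ZY).
    rewrite subsetI subsetIl /= -defZY normsI ?subsetIr //.
    exact: subset_trans (subsetIl _ _) nBG.
  have: #|G : 'N_G(ZY)| == 1%N.
    apply/eqP/(@pnat_1 p); last exact: pnat_dvd (indexgS G sSN) p'iS.
    apply: pnat_dvd (indexgS G sNN) _.
    have sZU: <[z]> \subset U by rewrite cycle_subG.
    by move: idx; rewrite /= (setIidPl sZU).
  by rewrite indexg_eq1 subsetI subxx.
have defB: ZY :=: B.
  apply/eqP; rewrite eqEproper join_subG cycle_subG Bz sYB /=.
  apply: contra nYz => prZY; apply: (subsetP (maxY ZY nsZYG prZY)).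
  by rewrite -cycle_subG joing_subl.
have oBY: #|B / Y| = p.
  have ->: B / Y = <[coset Y z]>.
    by rewrite -defB quotientYidr ?cycle_subG // quotient_cycle.
  apply: nt_prime_order => //; rewrite -morphX //= [LHS]coset_id //.
  exact: (expp_in_centBE nsBG pB ncB minB).
have sEG := normal_sub nsEG; have nYE := subset_trans sEG nYG.
(* Centralising [B / Y] would put [B = [~: B, E]] inside [Y]. *)
have: E / Y \subset 'C(B / Y).
  apply: cent_prime_order; rewrite /= ?oBY //.
    by rewrite quotient_norms // (subset_trans sEG).
  exact: coprime_dvdl (dvdn_quotient _ _) coE.
rewrite quotient_cents2 ?(subset_trans sBG) // commGC (commBE nsEG perfE nsBG pB ncB minB).
by move/subsetP/(_ z Bz); apply/negP.
Qed.

(** A section [Kb / Lb] of the image is a quotient of the preimage of [Kb] in [R]. *)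
Lemma morphim_quaternion_free (aT rT : finGroupType) (D R : {group aT})
    (f : {morphism D >-> rT}) :
  R \subset D -> quaternion_free R -> quaternion_free (f @* R)%G.
Proof.
move=> sRD qfR Kb Lb sKR nsLK isoQ.
pose K := (R :&: f @*^-1 Kb)%G.
have fK: f @* K = Kb by rewrite morphim_setIpre (setIidPr sKR).
pose h := comp_morphism f (coset_morphism Lb).
have sKh: K \subset f @*^-1 'N(Lb).
  by rewrite subIset // morphpreS ?orbT ?normal_norm.
have hK: h @* K = Kb / Lb by rewrite morphim_comp fK.
apply: (qfR K ('ker_K h)%G); first exact: subsetIl.
  rewrite /normal subsetIl normsI ?normG //.
  by rewrite (subset_trans sKh) ?ker_norm.
suffices isoK: K / 'ker_K h \isog Kb / Lb by apply: isog_trans isoK isoQ.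
by rewrite -hK; apply: first_isog_loc.
Qed.

(** The image of [H :&: U * T] modulo [U] is both a p-group and a p'-group. *)
Lemma pelt_setI_mulp' (p : nat) (gT : finGroupType) (H U T : {group gT}) :
  p.-group H -> p^'.-group T -> T \subset 'N(U) -> H :&: U * T \subset U.
Proof.
move=> pH p'T nUT; rewrite -norm_joinEr //.
have nU: H :&: U <*> T \subset 'N(U) by rewrite subIset // join_subG normG nUT orbT.
rewrite -quotient_sub1 // subG1 /= -(setIid (_ / _)) coprime_TIg //.
apply: (@pnat_coprime p).
  by apply: quotient_pgroup; apply: pgroupS pH; apply: subsetIl.
apply: (pgroupS (quotientS U (subsetIr H (U <*> T)))).
by rewrite /= quotientYidl // quotient_pgroup.
Qed.

(** The p-part of any preimage works: a power of it lying in [T] is trivial. *)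
Lemma lift_pelt (p : nat) (gT : finGroupType) (E T : {group gT}) (zb : coset_of T) :
  T <| E -> p^'.-group T -> zb \in E / T -> p.-elt zb ->
  exists z, [/\ z \in E, p.-elt z, #[z] = #[zb] & coset T z = zb].
Proof.
move=> nsTE p'T /morphimP[y Ny Ey ->] py.
have Ez: y.`_p \in E by apply: groupX.
have Nz: y.`_p \in 'N(T) by apply: groupX.
have defz: coset T y.`_p = coset T y.
  by rewrite morph_constt // constt_p_elt.
exists y.`_p; split=> //; first exact: p_elt_constt.
rewrite /= -defz; apply/eqP; rewrite eqn_dvd morph_order // andbT.
rewrite order_dvdn -order_eq1; set w := _ ^+ _.
have Tw: w \in T by apply: coset_idr; rewrite ?groupX // morphX // expg_order.
have pw: p.-elt w by rewrite p_eltX ?p_elt_constt.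
by rewrite -(part_pnat_id pw) part_p'nat //; apply: mem_p_elt p'T Tw.
Qed.

Lemma suitable_pelt (p : nat) (Q : Prop) (gT : finGroupType) (x : gT) :
  prime p -> suitable p Q x -> p.-elt x.
Proof.
by move=> p_pr; rewrite /p_elt; case=> [-> | [-> -> _] //]; rewrite pnat_id.
Qed.

Theorem pnil_of_weak_Pi_cyclic (p : nat) (Q : Prop) (gT : finGroupType)
    (G E : {group gT}) :
  prime p -> E <| G -> coprime #|E| p.-1 ->
  (forall R : {group gT}, p.-group R -> R \subset E -> Q \/ quaternion_free R) ->
  {in E, forall z, suitable p Q z -> weak_Pi p G <[z]>%G} ->
  pnil p E.
Proof.
move=> p_pr; have [n] := ubnP #|E|; elim: n => // n IHn in gT G E *.
move=> /ltnSE-leEn nsEG coE qfE wE.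
have [sEG nEG] := andP nsEG.
have minE (N : {group gT}) : N <| G -> N \proper E -> pnil p N.
  move=> nsNG prN; have sNE := proper_sub prN.
  apply: (IHn _ G) => //.
  - exact: leq_trans (proper_card prN) leEn.
  - exact: coprime_dvdl (cardSg sNE) coE.
  - by move=> R pR sRN; apply: qfE => //; apply: subset_trans sNE.
  by move=> z Nz; apply: wE; apply: (subsetP sNE).
have [p'T nsTE] : p^'.-group 'O_p^'(E) /\ 'O_p^'(E) <| E.
  by rewrite pcore_pgroup pcore_normal.
have nsTG: 'O_p^'(E) <| G by apply: gFnormal_trans.
have [T1 | ntT] := eqVneq 'O_p^'(E) 1; last first.
  set T := 'O_p^'(E)%G in p'T nsTE nsTG ntT; have nTG := normal_norm nsTG.
  apply: (pnil_quo_p' nsTE p'T); apply: (IHn _ (G / T)%G).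
  - by apply: leq_trans leEn; apply: ltn_quotient; rewrite ?pcore_sub.
  - exact: quotient_normal.
  - exact: coprime_dvdl (dvdn_quotient _ _) coE.
  - move=> Rb pRb sRb.
    have [K defK sTK sKE] := inv_quotientS nsTE sRb.
    have [R sylR] := Sylow_exists p K; have [sRK pR _] := and3P sylR.
    have nTR: R \subset 'N(T).
      exact: subset_trans sRK (subset_trans sKE (normal_norm nsTE)).
    have defRb: Rb = (R / T)%G.
      have hallRb: p.-Sylow(Rb) (R / T) by rewrite defK quotient_pHall.
      apply/val_inj/eqP; rewrite eq_sym eqEcard (pHall_sub hallRb) /=.
      by rewrite (card_Hall hallRb) part_pnat_id.
    case: (qfE R pR (subset_trans sRK sKE)) => [|qfR]; [by left | right].
    by rewrite defRb; apply: morphim_quaternion_free.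
  move=> zb Ezb szb.
  have [z [Ez pz oz defz]] := lift_pelt nsTE p'T Ezb (suitable_pelt p_pr szb).
  have wz: weak_Pi p G <[z]>%G by apply: wE; rewrite /suitable ?oz.
  have Nz: z \in 'N(T) by apply: (subsetP (normal_norm nsTE)).
  rewrite (_ : <[zb]>%G = (<[z]> / T)%G); last first.
    by apply: val_inj; rewrite /= quotient_cycle // defz.
  apply: weak_Pi_quotient wz => //; first by rewrite cycle_subG (subsetP sEG).
  move=> U nsUG; rewrite (subset_trans _ (mulG_subl _ _)) // subsetI subsetIl.
  apply: (pelt_setI_mulp' pz p'T).
  exact: subset_trans (normal_sub nsTG) (normal_norm nsUG).
apply/idPn=> nE; have perfE := no_p_quotient_of_minimal minE nsEG nE.
case/negP: nE; apply: (pnil_central_suitable p_pr qfE) => z Ez sz.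
have pz := suitable_pelt p_pr sz.
have ntz: z != 1.
  rewrite -order_gt1; case: sz => [-> | [_ -> _] //]; exact: prime_gt1.
have [||V [U [chVU idx nVz Uz]]] := weak_Pi_jump (Q := fun U => z \in U) (wE z Ez sz).
- by rewrite inE.
- exact: (subsetP sEG).
have [nsVG nsUG prVU] := chief_factor_normal chVU.
have sZU: <[z]> \subset U by rewrite cycle_subG.
have pUV: p.-group (U / V).
  apply: (pchief_factor chVU pz sZU); first by rewrite cycle_subG.
  by move: idx; rewrite /= (setIidPl sZU).
(* If [E] were inside [U], then [E / (E :&: V)] would be a p-group, forcing [E] and thus [z] into
   [V]. *)
have prB: E :&: U \proper E.
  rewrite properE subsetIl subsetI subxx /=; apply: contra nVz => sEU.
  have nVE: E \subset 'N(V) := subset_trans sEG (normal_norm nsVG).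
  have defE: E :&: V = E.
    apply: (perfE (E :&: V)%G); rewrite ?normalI ?subsetIl //.
    rewrite /= setIC (isog_pgroup _ (second_isog nVE)).
    exact: pgroupS (quotientS V sEU) pUV.
  by move: Ez; rewrite -{1}defE => /setIP[].
have nsBG: E :&: U <| G by apply: normalI.
(* [E :&: U] is p-nilpotent by minimality, and its normal p-complement lies in ['O_p^'(E) = 1]. *)
have pB: p.-group (E :&: U).
  have nilB: pnil p (E :&: U)%G := minE (E :&: U)%G nsBG prB.
  have sO: 'O_p^'(E :&: U) \subset 'O_p^'(E).
    apply: pcore_max (pcore_pgroup _ _) _.
    by rewrite gFnormal_trans // (normalS (subsetIl E U) sEG nsBG).
  move: nilB; rewrite T1 subG1 in sO.
  by rewrite /pnil pHall_p'E ?pcore_sub //= (eqP sO) indexg1 => /andP[].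
have cBE: E \subset 'C(E :&: U).
  apply: (cent_pgroup_weak_Pi p_pr nsEG coE perfE (B0 := (E :&: U)%G) (Q := Q)) => //.
    by move=> y /setIP[Ey _]; apply: wE.
  move=> R sRB; apply: qfE; first exact: pgroupS sRB pB.
  exact: subset_trans sRB (subsetIl _ _).
by rewrite centsC in cBE; apply: (subsetP cBE); rewrite inE Ez.
Qed.

(** * Maximal subgroups *)

Lemma pgroup_sub_p'quotient (p : nat) (gT : finGroupType) (R K N : {group gT}) :
  p.-group R -> R \subset K -> K \subset 'N(N) -> p^'.-group (K / N) -> R \subset N.
Proof.
move=> pR sRK nNK p'KN; have nNR := subset_trans sRK nNK.
rewrite -quotient_sub1 // subG1 /= -(setIid (_ / _)) coprime_TIg //.
apply: (@pnat_coprime p); first exact: quotient_pgroup.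
exact: pgroupS (quotientS N sRK) p'KN.
Qed.

(** A p-subgroup of [K1 :&: K2] lies in [N1 :&: N2 = 1], so [K1 :&: K2] is a normal p-complement. *)
Lemma pnil_subdirect (p : nat) (gT : finGroupType) (E N1 N2 : {group gT}) :
  N1 <| E -> N2 <| E -> N1 :&: N2 = 1 -> pnil p (E / N1) -> pnil p (E / N2) ->
  pnil p E.
Proof.
move=> ns1 ns2 ti12 nil1 nil2.
have [K1 [nsK1 _ _ p'K1 pEK1]] := pnil_quotient_kernel (normal_refl E) ns1 (normal_sub ns1) nil1.
have [K2 [nsK2 _ _ p'K2 pEK2]] := pnil_quotient_kernel (normal_refl E) ns2 (normal_sub ns2) nil2.
have sK12: K1 :&: K2 \subset E by rewrite subIset ?normal_sub.
apply/pnilP; exists (K1 :&: K2)%G; split; first exact: normalI.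
rewrite pHall_p'E //; apply/andP; split.
  have [R sylR] := Sylow_exists p (K1 :&: K2)%G; have [sRK pR _] := and3P sylR.
  have [sR1 sR2] : R \subset K1 /\ R \subset K2 by apply/andP; rewrite -subsetI.
  have R1: R :=: 1.
    apply/trivgP; rewrite -ti12 subsetI.
    rewrite (pgroup_sub_p'quotient pR sR1) ?(pgroup_sub_p'quotient pR sR2) //.
      exact: subset_trans (normal_sub nsK2) (normal_norm ns2).
    exact: subset_trans (normal_sub nsK1) (normal_norm ns1).
  by case/and3P: sylR => _ _; rewrite R1 indexg1.
rewrite /= -(Lagrange_index (normal_sub nsK1)) ?subsetIl // pnatM pEK1 /=.
have nK2E := normal_norm nsK2; have sK1E := normal_sub nsK1.
rewrite indexgI -card_quotient ?(subset_trans sK1E) //.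
by rewrite -card_quotient // in pEK2; apply: pnat_dvd (cardSg (quotientS K2 sK1E)) pEK2.
Qed.

(** [U] is the first term containing [N]; minimality of [N] and chiefness of [U / V] give the
    rest. *)
Lemma weak_Pi_minnormal (p : nat) (gT : finGroupType) (G M N : {group gT}) :
  weak_Pi p G M -> minnormal N G -> N \subset G ->
  exists V U : {group gT}, [/\ chief_factor G V U, p.-nat #|G : 'N_G((M :&: U) <*> V)|,
    N :&: V = 1 & U :=: N * V].
Proof.
move=> wM /mingroupP[/andP[ntN nNG] minN] sNG.
have [||V [U [chVU idx nNV sNU]]] := weak_Pi_jump (Q := fun U : {group gT} => N \subset U) wM.
- by rewrite subG1.
- exact: sNG.
have [nsVG nsUG prVU] := chief_factor_normal chVU.
exists V, U; split=> //.
  apply/eqP; apply: contraR nNV => ntI.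
  apply/setIidPl; apply: (minN (N :&: V)%G); last exact: subsetIl.
  by rewrite /= ntI normsI ?(normal_norm nsVG).
rewrite -norm_joinEl ?(subset_trans sNG) ?normal_norm //.
apply/eqP; rewrite eqEsubset join_subG sNU (proper_sub prVU) !andbT.
apply: contraR nNV => nU; rewrite -(chief_factor_max chVU (N := (N <*> V)%G)) ?joing_subl ?joing_subr //.
  by rewrite normalY // /normal sNG.
by rewrite join_subG sNU proper_sub.
Qed.

Lemma weak_Pi_maximal_quotient (p : nat) (gT : finGroupType) (G P B : {group gT}) :
  prime p -> p.-group P -> P \subset G -> B <| G -> p^'.-group B \/ B \subset P ->
  (forall M : {group gT}, maximal M P -> weak_Pi p G M) ->
  forall M : {group coset_of B}, maximal M (P / B) -> weak_Pi p (G / B) M.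
Proof.
move=> p_pr pP sPG nsBG p'B_sBP wP Mb maxMb.
have nBG := normal_norm nsBG; have nBP := subset_trans sPG nBG.
have sMbP: Mb \subset P / B by case/maxgroupP: maxMb => /proper_sub.
pose M := (P :&: coset B @*^-1 Mb)%G.
have sMP: M \subset P := subsetIl _ _.
have defMb: Mb = (M / B)%G.
  by apply/val_inj; rewrite /= /quotient morphim_setIpre (setIidPr sMbP).
have maxM: maximal M P.
  apply: p_index_maximal => //.
  rewrite -(index_quotient_eq (H := B)) //; last by rewrite setIS ?sub_cosetpre.
  rewrite -[(M / B)%g]/(gval (M / B)%G) -defMb.
  by rewrite (p_maximal_index (quotient_pgroup B pP)).
rewrite defMb; apply: weak_Pi_quotient (wP M maxM) => //; first exact: subset_trans sPG.
move=> U nsUG; case: p'B_sBP => [p'B | sBP].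
  rewrite (subset_trans _ (mulG_subl _ _)) // subsetI subsetIl.
  apply: (pelt_setI_mulp' (pgroupS sMP pP) p'B).
  exact: subset_trans (normal_sub nsBG) (normal_norm nsUG).
by rewrite group_modr // subsetI sBP sub_cosetpre.
Qed.

(** Some maximal subgroup [M] of [P] meets [N] nontrivially. At the step where the series absorbs
    [N], [M :&: U] is not inside [V], so [U / V] is a p-group, and [N] embeds in it. *)
Lemma minnormal_pgroup (p : nat) (gT : finGroupType) (G E P N : {group gT}) :
  prime p -> E <| G -> p.-Sylow(E) P -> P :!=: 1 -> #|P| != p ->
  'O_p^'(E) = 1 ->
  (forall M : {group gT}, maximal M P -> weak_Pi p G M) ->
  minnormal N G -> N \subset E -> p.-group N.
Proof.
move=> p_pr nsEG sylP ntP oP T1 wP minN sNE; have [sPE pP _] := and3P sylP.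
have [sEG nEG] := andP nsEG; have sNG := subset_trans sNE sEG.
have [/andP[ntN nNG] _] := mingroupP minN.
have nsNE: N <| E by rewrite /normal sNE (subset_trans sEG).
have sylNP: p.-Sylow(N) (N :&: P) by apply: Sylow_setI_normal nsNE sylP.
have ntNP: N :&: P != 1.
  apply: contraNneq ntN => NP1; rewrite -subG1 -T1 pcore_max //.
  by case/and3P: sylNP => _ _; rewrite NP1 indexg1.
have [M maxM ntNM]: exists2 M : {group gT}, maximal M P & N :&: M != 1.
  have [defP | [M maxM sM]] := maximal_exists (subsetIr N P); last first.
    exists M => //; apply: contra ntNP; rewrite -!subG1; apply: subset_trans.
    by rewrite subsetI subsetIl.
  have sPN: P \subset N by rewrite -defP subsetIl.
  have [P1 | [M maxM _]] := maximal_exists (sub1G P); first by rewrite -P1 eqxx in ntP.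
  have sMP: M \subset P by case/maxgroupP: maxM => /proper_sub.
  (* Any maximal subgroup will do when [P] lies in [N], since [#|P| != p] makes it nontrivial. *)
  exists M => //; rewrite (setIidPr (subset_trans sMP sPN)).
  apply: contraNneq oP => M1.
  by rewrite -(p_maximal_index pP maxM) M1 indexg1.
have sMP: M \subset P by case/maxgroupP: maxM => /proper_sub.
have [V [U [chVU idx tiNV defU]]] := weak_Pi_minnormal (wP M maxM) minN sNG.
have [nsVG _ _] := chief_factor_normal chVU.
have nVN := subset_trans sNG (normal_norm nsVG).
have sNU: N \subset U by rewrite defU mulG_subl.
have pUV: p.-group (U / V).
  apply: (pchief_factor chVU (pgroupS (subsetIl M U) (pgroupS sMP pP)) (subsetIr M U)) => //.
  apply: contra ntNM => sMUV; rewrite -subG1 -tiNV subsetI subsetIl.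
  by rewrite (subset_trans _ sMUV) // subsetI subsetIr subIset // sNU.
rewrite (isog_pgroup _ (quotient1_isog N)) -tiNV setIC.
rewrite (isog_pgroup _ (second_isog nVN)).
exact: pgroupS (quotientS V sNU) pUV.
Qed.

Theorem pnil_of_weak_Pi_maximal (p : nat) (gT : finGroupType) (G E P : {group gT}) :
  prime p -> E <| G -> p.-Sylow(E) P -> coprime #|E| p.-1 ->
  (forall M : {group gT}, maximal M P -> weak_Pi p G M) ->
  pnil p E.
Proof.
move=> p_pr; have [n] := ubnP #|E|; elim: n => // n IHn in gT G E P *.
move=> /ltnSE-leEn nsEG sylP coE wP.
have [sEG nEG] := andP nsEG; have [sPE pP p'iP] := and3P sylP.
have sPG := subset_trans sPE sEG.
have quoE (B : {group gT}) : B <| G -> B \subset E -> B :!=: 1 ->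
    p^'.-group B \/ B \subset P -> pnil p (E / B).
  move=> nsBG sBE ntB p'B_sBP; have nBG := normal_norm nsBG.
  apply: (IHn _ (G / B)%G _ (P / B)%G).
  - by apply: leq_trans leEn; apply: ltn_quotient.
  - exact: quotient_normal.
  - by apply: quotient_pHall; rewrite // (subset_trans sPG).
  - exact: coprime_dvdl (dvdn_quotient _ _) coE.
  exact: weak_Pi_maximal_quotient.
have nsTG: 'O_p^'(E) <| G by apply: gFnormal_trans.
have [T1 | ntT] := eqVneq 'O_p^'(E) 1; last first.
  apply: (pnil_quo_p' (pcore_normal p^' E) (pcore_pgroup _ _)).
  by apply: quoE; rewrite ?pcore_sub //; left; apply: pcore_pgroup.
have [P1 | ntP] := eqVneq P 1%G.
  by apply: p'group_pnil; rewrite P1 indexg1 in p'iP.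
have [oP | oP] := eqVneq #|P| p; first exact: Burnside_prime_Sylow sylP oP coE.
apply/idPn=> nE.
have minp (N : {group gT}) : minnormal N G -> N \subset E ->
    [/\ p.-group N, N <| G, N \subset P & pnil p (E / N)].
  move=> minN sNE; have [/andP[ntN nNG] _] := mingroupP minN.
  have pN: p.-group N by apply: minnormal_pgroup wP minN sNE.
  have nsNG: N <| G by rewrite /normal (subset_trans sNE).
  have sNP: N \subset P.
    by apply: (normal_sub_max_pgroup (Hall_max sylP) pN); apply: normalS nsNG.
  by split=> //; apply: quoE => //; right.
have uniqN (N1 N2 : {group gT}) : minnormal N1 G -> minnormal N2 G ->
    N1 \subset E -> N2 \subset E -> N1 :&: N2 != 1.
  move=> min1 min2 s1 s2; apply: contra nE => /eqP ti12.
  have [[_ ns1 _ nil1] [_ ns2 _ nil2]] := (minp N1 min1 s1, minp N2 min2 s2).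
  by apply: pnil_subdirect ti12 nil1 nil2; apply: normalS sEG _.
have ntE: E :!=: 1 by apply: contraNneq ntP => E1; rewrite -val_eqE -subG1 /= -E1.
have [N minN sNE] := minnormal_exists ntE nEG.
have [/andP[ntN nNG] minNP] := mingroupP minN.
have [pN nsNG sNP nilEN] := minp N minN sNE.
have sNG := subset_trans sNE sEG.
have [K [nsKG sNK sKE p'KN pEK]] := pnil_quotient_kernel nsEG nsNG sNE nilEN.
have [_ _ abelN] := minnormal_solvable minN (subxx N) (pgroup_sol pN).
have cNN: abelian N by case/is_abelemP: abelN => q _ /abelem_abelian.
have nsNK: N <| K := normalS sNK (normal_sub nsKG) nsNG.
have coNiK: coprime #|N| #|K : N|.
  by rewrite (pnat_coprime pN) // -card_quotient ?normal_norm.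
have hallN: Hall K N by rewrite /Hall sNK.
have /splitsP[Q /complP[tiNQ defK]] := SchurZassenhaus_split hallN nsNK.
have sQK: Q \subset K by rewrite -defK mulG_subr.
have nNQ: Q \subset 'N(N) := subset_trans sQK (normal_norm nsNK).
have oQ: #|Q| = #|K : N| by rewrite -divgS // -defK TI_cardMg // mulKn.
have p'Q: p^'.-group Q by rewrite /pgroup oQ -card_quotient ?normal_norm.
have coNQ: coprime #|N| #|Q| by rewrite oQ.
(* Frattini argument: the complements of [N] in [K] are conjugate under [N]. *)
have defG: 'N_G(Q) * N = G.
  apply/eqP; rewrite eqEsubset mul_subG ?subsetIl //=; apply/subsetP=> g Gg.
  have sQg: Q :^ g \subset N * Q.
    by rewrite defK -(normP (subsetP (normal_norm nsKG) g Gg)) conjSg.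
  have [x Nx defQg] := SchurZassenhaus_trans_sol (K1 := (Q :^ g)%G)
    (pgroup_sol pN) nNQ sQg coNQ (cardJg Q g).
  rewrite -(mulgKV x g) mem_mulg // inE groupM ?groupV ?(subsetP sNG x Nx) //=.
  by apply/normP; rewrite conjsgM defQg -conjsgM mulgV conjsg1.
(* The intersection is normal in [G], as [N] is abelian, so otherwise it is [N]. Then [Q] is normal
   in [E], hence trivial, and [E] is a p-group. *)
have tiNL: N :&: 'N(Q) = 1.
  have nsC: G \subset 'N(N :&: 'N_G(Q)).
    rewrite -{1}defG mul_subG //.
      by rewrite normsI ?normG // (subset_trans (subsetIl _ _)).
    by rewrite cents_norm // (centsS (subsetIl _ _)).
  have defC: N :&: 'N_G(Q) = N :&: 'N(Q) by rewrite setIA (setIidPl sNG).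
  rewrite defC in nsC; apply: contraNeq nE => ntC.
  have sNnQ: N \subset 'N(Q).
    apply/setIidPl; apply: (minNP (N :&: 'N(Q))%G); last exact: subsetIl.
    by rewrite /= ntC.
  have nsQE: Q <| E.
    rewrite /normal (subset_trans sQK) // (subset_trans sEG) // -defG.
    by rewrite mul_subG ?subsetIr.
  have Q1: Q :=: 1 by apply/trivgP; rewrite -T1 pcore_max.
  apply: pgroup_pnil; rewrite /pgroup -(Lagrange sKE) pnatM pEK andbT.
  by rewrite -defK Q1 mulg1.
have [S sylS sPS] := Sylow_superset sPG pP; have [sSG pS p'iS] := and3P sylS.
pose L := (P :&: 'N_G(Q))%G.
have defP: N * L = P.
  rewrite /= (setIC P) group_modl // -(normC (subset_trans _ nNG)) ?subsetIl //.
  by rewrite defG (setIidPr sPG).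
have tiNL': N :&: L = 1.
  apply/trivgP; rewrite -tiNL setIS // (subset_trans (subsetIr _ _)) //.
  exact: subsetIr.
have nsNS: N <| S by apply: normalS nsNG; rewrite ?(subset_trans sNP).
have [_ _ [r oN]] := pgroup_pdiv pN ntN.
have [|N1 [sN1N nsN1S oN1]] := normal_pgroup (r := r) pS nsNS.
  by rewrite oN pfactorK.
have sLS: L \subset S := subset_trans (subsetIl _ _) sPS.
have nN1L: L \subset 'N(N1) := subset_trans sLS (normal_norm nsN1S).
have tiN1L: N1 :&: L = 1 by apply/trivgP; rewrite -tiNL' setSI.
pose M := (N1 <*> L)%G.
have defM: M :=: N1 * L by rewrite /= norm_joinEr.
have sMP: M \subset P by rewrite defM -defP mulSg.
have iPM: #|P : M| = p.
  rewrite -divgS // defM -defP !TI_cardMg // oN oN1 expnS -mulnA mulnK //.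
  by rewrite muln_gt0 expn_gt0 prime_gt0 ?cardG_gt0.
have maxM: maximal M P by apply: p_index_maximal; rewrite ?iPM.
have [V [U [chVU idx tiNV defU]]] := weak_Pi_minnormal (wP M maxM) minN sNG.
have [nsVG _ _] := chief_factor_normal chVU.
(* Otherwise a minimal normal subgroup inside [V :&: E] would meet [N] trivially, against
   [uniqN]. *)
have tiVE: V :&: E = 1.
  apply/eqP/negPn/negP=> ntVE.
  have nVE: G \subset 'N(V :&: E) by rewrite normsI ?normal_norm.
  have [N' minN' sN'] := minnormal_exists (H := (V :&: E)%G) ntVE nVE.
  have /subsetIP[sN'V sN'E] := sN'.
  case/negP: (uniqN N N' minN minN' sNE sN'E).
  by rewrite -subG1 -tiNV setIS.
have defUE: U :&: E = N by rewrite defU -group_modl // tiVE mulg1.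
have sME := subset_trans sMP sPE.
have tiML: M :&: U = N1.
  rewrite -(setIidPl sME) -setIA (setIC E) defUE defM.
  by rewrite -group_modl // (setIC L) tiNL' mulg1.
have nVN1: N1 \subset 'N(V).
  exact: subset_trans sN1N (subset_trans sNG (normal_norm nsVG)).
have defN1: (N1 <*> V) :&: E = N1.
  by rewrite norm_joinEl // -group_modl ?(subset_trans sN1N) // tiVE mulg1.
(* The index of ['N_G(N1)] is prime to [p] because of [S], and a power of [p] because
   [N1 = (N1 <*> V) :&: E]. *)
have nN1G: G \subset 'N(N1).
  have sSN: S \subset 'N_G(N1) by rewrite subsetI sSG normal_norm.
  have sVN: 'N_G(N1 <*> V) \subset 'N_G(N1).
    rewrite subsetI subsetIl -{2}defN1 normsI ?subsetIr //.
    exact: subset_trans (subsetIl _ _) nEG.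
  have: #|G : 'N_G(N1)| == 1%N.
    apply/eqP/(@pnat_1 p); last exact: pnat_dvd (indexgS G sSN) p'iS.
    by apply: pnat_dvd (indexgS G sVN) _; rewrite /= tiML in idx.
  by rewrite indexg_eq1 subsetI subxx.
have N11: N1 :=: 1.
  apply/eqP; apply: contraT => ntN1.
  have defN: N1 :=: N by apply: minNP; rewrite ?ntN1.
  have: #|N1| = #|N| by rewrite defN.
  by rewrite oN1 oN => /eqP; rewrite eqn_exp2l ?prime_gt1 // => /eqP/n_Sn.
have oNp: #|N| = p.
  have: #|N1| = 1%N by rewrite N11 cards1.
  rewrite oN1 oN expnS => ->; exact: muln1.
have cEN: E \subset 'C(N).
  by apply: cent_prime_order; rewrite ?oNp // (subset_trans sEG).
(* [Q] centralises [N], so [N] normalises [Q], against [tiNL]. *)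
case/negP: ntN; rewrite -subG1 -tiNL subsetI subxx cents_norm //.
by rewrite centsC (subset_trans (subset_trans sQK sKE)).
Qed.

(** * Passage from the partial Pi-property to its weak form *)

(** The quantifiers range over finite types, so no classical axiom is involved. *)
Lemma quaternion_free_dec (gT : finGroupType) (P : {group gT}) :
  quaternion_free P \/ ~ quaternion_free P.
Proof.
pose qf := [forall K : {group gT}, forall L : {group gT},
  (K \subset P) ==> (L <| K) ==> ~~ (K / L \isog 'Q_8)].
have [/forallP qfP | nqf] := boolP qf; [left | right].
  move=> K L sKP nsLK; apply/negP.
  by have /forallP/(_ L) := qfP K; rewrite sKP nsLK.
move=> qfP; case/negP: nqf; apply/forallP=> K; apply/forallP=> L.
by apply/implyP=> sKP; apply/implyP=> nsLK; apply/negP; apply: qfP.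
Qed.

Theorem proposition1p7 (p : nat) (gT : finGroupType) (G E P : {group gT})
    (p_pr : prime p) (nsEG : E <| G) (sylP : p.-Sylow(E) P)
    (co_E_p1 : coprime #|E| p.-1)
    (hP : (forall M : {group gT}, maximal M P -> partial_Pi_property G M) \/
          (forall C : {group gT}, C \subset P -> cyclic C ->
             prime #|C| \/ (#|C| = 4 /\ ~ quaternion_free P) ->
             partial_Pi_property G C)) :
  p_nilpotent p E.
Proof.
apply/pnilP; have [sPE pP _] := and3P sylP.
have sPG := subset_trans sPE (normal_sub nsEG).
case: hP => hP.
  apply: pnil_of_weak_Pi_maximal nsEG sylP co_E_p1 _ => // M maxM.
  have sMP: M \subset P by case/maxgroupP: maxM => /proper_sub.
  exact: partial_Pi_weak (pgroupS sMP pP) (subset_trans sMP sPG) (hP M maxM).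
apply: (pnil_of_weak_Pi_cyclic (Q := ~ quaternion_free P) p_pr nsEG co_E_p1).
  (* A p-subgroup of [E] lies in a conjugate of [P], which inherits quaternion-freeness. *)
  move=> R pR sRE; case: (quaternion_free_dec P) => [qfP | nqfP]; [right | by left].
  have [x Ex sRP] := Sylow_subJ sylP sRE pR.
  have qfPx: quaternion_free (P :^ x)%G.
    have ->: (P :^ x)%G = (conjgm_morphism P x @* P)%G.
      by apply/val_inj; rewrite /= morphim_conj setIid.
    exact: morphim_quaternion_free (subxx P) qfP.
  by move=> K L sKR; apply: qfPx; apply: subset_trans sKR sRP.
move=> z Ez sz; have pz := suitable_pelt p_pr sz.
have sZE: <[z]> \subset E by rewrite cycle_subG.
(* The hypothesis only concerns subgroups of [P], so [<[z]>] is moved into [P] and the weak property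
   is conjugated back. *)
have [x Ex sZP] := Sylow_Jsub sylP sZE pz.
have Gx: x \in G := subsetP (normal_sub nsEG) x Ex.
pose C := (<[z]> :^ x)%G; have oC: #|C| = #[z] by apply: cardJg.
have wC: weak_Pi p G C.
  apply: partial_Pi_weak (pgroupS sZP pP) (subset_trans sZP sPG) _.
  apply: hP => //; first by rewrite cyclicJ cycle_cyclic.
  by rewrite oC; case: sz => [-> | [_ -> nqf]]; [left | right].
have:= weak_Pi_conj (groupVr Gx) wC.
rewrite (_ : (C :^ x^-1)%G = <[z]>%G) //.
by apply/val_inj; apply: conjsgK.
Qed.
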